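(* Fix a hyperplane $H$ in $\mathbb{C}P^n$ and two distinct points $x_0,x_\infty\in H$. Then, modulo the action of $\mathrm{Aut}(\mathbb{C}P^n;H)$, there exists a unique rational curve of degree $2$ in $\mathbb{C}P^n$ that is not contained in $H$ and passes through $x_0$ and $x_\infty$.
   Context: $\mathrm{Aut}(\mathbb{C}P^n;H)$ is the group of automorphisms of $\mathbb{C}P^n$ fixing $H$; writing $\mathbb{C}P^n=\mathbb P(1\oplus\mathbb C^n)$, $H=\mathbb P(0\oplus\mathbb C^n)$, it consists of the maps which on $\mathbb{C}P^n\setminus H\cong\mathbb C^n$ are $v\mapsto cv+a$ with $c\in\mathbb C^*$, $a\in\mathbb C^n$. A rational curve of degree 2 is the image of a holomorphic map $S^2=\mathbb CP^1\to\mathbb CP^n$ of degree 2 (maps being considered up to reparametrization of $\mathbb CP^1$). *)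

(* Defs.v *)
From HB Require Import structures.
From mathcomp Require Import all_boot all_order all_algebra.
From mathcomp Require Import complex.
From mathcomp Require Import boolp classical_sets reals topology normedtype.
From mathcomp Require Import derive Rstruct.

Set Implicit Arguments.
Unset Strict Implicit.
Unset Printing Implicit Defensive.

Import Order.TTheory GRing.Theory Num.Theory.
Import numFieldNormedType.Exports.

Local Open Scope ring_scope.
Local Open Scope classical_set_scope.

(* C^o below is C with its norm topology, viewed as a normed space over C, so
   that derivable f z 1, for f : C^o -> C^o, is complex differentiability. *)
Notation C := (complex Rdefinitions.R).

(* Points of CP^n are the lines through the origin of C^(n+1). *)
Definition CP (n : nat) := {U : {vspace 'rV[C]_n.+1} | \dim U == 1%N}.

Definition hyperplane n (H : {vspace 'rV[C]_n.+1}) := \dim H = n.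

Definition pts n (H : {vspace 'rV[C]_n.+1}) : set (CP n) :=
  [set p | (val p <= H)%VS].

Lemma dim_vline_eq1 n (v : 'rV[C]_n.+1) : v != 0 -> \dim <[v]>%VS == 1%N.
Proof. by move=> v0; rewrite dim_vline v0. Qed.

Definition pt n (v : 'rV[C]_n.+1) (v0 : v != 0) : CP n :=
  exist _ <[v]>%VS (dim_vline_eq1 v0).

Definition chart_vec (i : 'I_2) (z : C) : 'rV[C]_2 :=
  \row_j (if j == i then 1 else z).

Lemma chart_vec_neq0 i z : chart_vec i z != 0.
Proof.
apply/eqP => /rowP /(_ i); rewrite !mxE eqxx => /eqP.
by rewrite oner_eq0.
Qed.

(* chart 0 z = [1 : z] and chart 1 z = [z : 1]. *)
Definition chart (i : 'I_2) (z : C) : CP 1 := pt (chart_vec_neq0 i z).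

(* F is a holomorphic lift of h to C^(n+1) \ {0} near z0; the equality of
   subspaces forces F z != 0. *)
Definition lift_near n (h : C -> CP n) (z0 : C) (F : C -> 'rV[C]_n.+1) :=
  \forall z \near (z0 : C^o),
    val (h z) = <[F z]>%VS /\
    forall j, derivable (fun w : C^o => F w 0 j : C^o) z 1.

Definition holomorphic n (f : CP 1 -> CP n) :=
  forall i z0, exists F, lift_near (f \o chart i) z0 F.

(* The pullback of the hyperplane H by f vanishes to order m at p. *)
Definition inter_mult n (f : CP 1 -> CP n) (H : {vspace 'rV[C]_n.+1})
    (p : CP 1) (m : nat) :=
  exists (i : 'I_2) (z0 : C) (F : C -> 'rV[C]_n.+1)
         (l : 'Hom('rV[C]_n.+1, C^o)) (g : C^o -> C^o),
    chart i z0 = p /\ lift_near (f \o chart i) z0 F /\ lker l = H /\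
    g z0 != 0 /\
    \forall z \near (z0 : C^o),
      derivable g z 1 /\ l (F z) = (z - z0) ^+ m * g z.

(* The degree is the number of points, counted with multiplicity, in which f
   meets any hyperplane not containing its image; this is the degree of the
   pullback by f of the hyperplane bundle, i.e. f_*[CP^1] in H_2(CP^n) = Z. *)
Definition has_degree n (f : CP 1 -> CP n) (d : nat) :=
  forall H : {vspace 'rV[C]_n.+1}, hyperplane H -> ~ (range f `<=` pts H) ->
  exists (s : seq (CP 1)) (mu : CP 1 -> nat),
    uniq s /\ (forall p, p \in s <-> pts H (f p)) /\
    (forall p, p \in s -> inter_mult f H p (mu p)) /\
    (\sum_(p <- s) mu p)%N = d.

(* Automorphisms of CP^1 as a complex manifold. *)
Definition reparametrization (phi : CP 1 -> CP 1) :=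
  holomorphic phi /\
  exists psi, holomorphic psi /\ cancel phi psi /\ cancel psi phi.

(* A rational curve is given by a parametrization; two parametrizations define
   the same curve when they differ by a reparametrization of CP^1. *)
Definition same_curve n (f1 f2 : CP 1 -> CP n) :=
  exists phi, reparametrization phi /\ f2 = f1 \o phi.

Definition rational_curve n (d : nat) (f : CP 1 -> CP n) :=
  holomorphic f /\ has_degree f d.

Definition automorphism n (g : CP n -> CP n) :=
  exists L : 'End('rV[C]_n.+1),
    lker L = 0%VS /\ forall p, val (g p) = (L @: val p)%VS.

(* The group Aut(CP^n; H): H is fixed pointwise, see AutE. *)
Definition Aut n (H : {vspace 'rV[C]_n.+1}) (g : CP n -> CP n) :=
  automorphism g /\ forall p, pts H p -> g p = p.

Lemma same_curve_range n (f1 f2 : CP 1 -> CP n) :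
  same_curve f1 f2 -> range f1 = range f2.
Proof.
move=> [phi [[_ [psi [_ [_ psiK]]]] ->]]; apply/seteqP; split=> [p|p] /=.
  by case=> q _ <-; exists (psi q) => //=; rewrite psiK.
by case=> q _ <-; exists (phi q).
Qed.

Lemma hyperplane_split n (H : {vspace 'rV[C]_n.+1}) (e : 'rV[C]_n.+1) :
  hyperplane H -> e \notin H ->
  (<[e]> :&: H = 0)%VS /\ (<[e]> + H = fullv)%VS.
Proof.
move=> dH eH.
have e0 : e != 0 by apply: contraNneq eH => ->; apply: mem0v.
have dE : (<[e]> :&: H = 0)%VS.
  apply/eqP; rewrite -subv0; apply/subvP => x.
  rewrite memv_cap memv0 => /andP[/vlineP[k ->]] kH.
  case: (eqVneq k 0) => [->|k0]; first by rewrite scale0r.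
  by move: eH; rewrite -(scalerK k0 e) memvZ.
split=> //; apply/eqP; rewrite eqEdim subvf /=.
rewrite dimv_disjoint_sum // dim_vline e0 dH.
by rewrite dimvf /dim /= mul1n.
Qed.

(* On the affine chart v |-> [e + v], v in H, of the complement of H, Aut(CP^n; H)
   consists of the maps v |-> c v + a. *)
Lemma AutE n (H : {vspace 'rV[C]_n.+1}) (e : 'rV[C]_n.+1) (g : CP n -> CP n) :
  hyperplane H -> e \notin H ->
  Aut H g <->
  (exists (c : C) (a : 'rV[C]_n.+1), c != 0 /\ a \in H /\
     (forall p v, v \in H -> val p = <[e + v]>%VS ->
        val (g p) = <[e + (c *: v + a)]>%VS) /\
     forall p, pts H p -> g p = p).
Proof.
move=> dH eH; have [capEH addEH] := hyperplane_split dH eH.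
have dec x : exists t v, v \in H /\ x = t *: e + v.
  have : x \in (<[e]> + H)%VS by rewrite addEH memvf.
  by move=> /memv_addP[u /vlineP[t ->] [v vH ->]]; exists t, v.
split.
- move=> [[L [kL gL]] gH].
  have Linj x : L x = 0 -> x = 0.
    by move=> Lx; apply/eqP; rewrite -memv0 -kL memv_ker Lx.
  have eig v : v \in H -> exists k, L v = k *: v.
    move=> vH; case: (eqVneq v 0) => [->|v0]; first by exists 0; rewrite linear0 scaler0.
    have /(congr1 val) := gH (pt v0) vH.
    rewrite gL /= limg_line => LE.
    by apply/vlineP; rewrite -LE memv_line.
  have [k [k0 Lk]] : exists k, k != 0 /\ forall v, v \in H -> L v = k *: v.
    case: (eqVneq (vpick H) 0) => [/eqP|w0].
      rewrite vpick0 => /eqP H0; exists 1; split; first exact: oner_neq0.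
      by move=> v; rewrite H0 memv0 => /eqP ->; rewrite linear0 scaler0.
    set w := vpick H in w0.
    have wH : w \in H := memv_pick H.
    have [k Lw] := eig w wH; exists k; split.
      by apply: contraNneq w0 => k0; apply/eqP/Linj; rewrite Lw k0 scale0r.
    move=> v vH.
    have [m Lv] := eig v vH.
    have [q] := eig (v + w) (rpredD vH wH).
    rewrite linearD /= Lv Lw scalerDr => E.
    case: (eqVneq m q) => [mq|mq].
      rewrite mq in Lv E *.
      move: E => /addrI /eqP.
      by rewrite -subr_eq0 -scalerBl scaler_eq0 (negbTE w0) orbF subr_eq0 => /eqP ->.
    have : (m - q) *: v = (q - k) *: w.
      rewrite !scalerBl; apply/eqP; rewrite subr_eq addrAC eq_sym subr_eq.
      by rewrite E addrC.
    move=> /(congr1 (fun x => (m - q)^-1 *: x)).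
    rewrite scalerK ?subr_eq0 // scalerA => vE.
    have LZ r : L (r *: w) = r *: L w by rewrite linearZ.
    by rewrite -Lv vE LZ Lw !scalerA mulrC.
  have [t [a [aH Le]]] := dec (L e).
  have t0 : t != 0.
    apply/eqP => t0; rewrite t0 scale0r add0r in Le.
    have : L (e - k^-1 *: a) = 0.
      by rewrite linearB linearZ /= Le Lk // scalerA mulVf // scale1r subrr.
    by move=> /Linj /eqP; rewrite subr_eq0 => /eqP eE; move: eH; rewrite eE memvZ.
  exists (k / t), (t^-1 *: a); split; first by rewrite mulf_neq0 ?invr_neq0.
  split; first exact: memvZ.
  split=> // p v vH pE; rewrite gL pE limg_line linearD /= Le Lk //.
  have -> : t *: e + a + k *: v = t *: (e + (k / t *: v + t^-1 *: a)).
    by rewrite !scalerDr !scalerA mulrCA mulfV // mulr1 scale1r addrAC addrA.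
  apply/eqP; rewrite eqEsubv -!memvE memvZ ?memv_line //=.
  by rewrite -{1}(scalerK t0 (e + _)) memvZ ?memv_line.
- move=> [c [a [c0 [aH [gE gH]]]]]; split=> //.
  have e0 : e != 0 by apply: contraNneq eH => ->; apply: mem0v.
  pose P := daddv_pi <[e]> H.
  pose l x := coord [tuple e] ord0 (P x).
  have lE t v : v \in H -> l (t *: e + v) = t.
    move=> vH; rewrite /l.
    have -> : P (t *: e + v) = t *: e.
      have te : t *: e \in <[e]>%VS by rewrite memvZ ?memv_line.
      have capHE : (H :&: <[e]> = 0)%VS by rewrite capvC.
      have vEH : v \in (<[e]> + H)%VS by rewrite addEH memvf.
      rewrite linearD /= /P (daddv_pi_id capEH te).
      have /(congr1 (fun x => x - v)) := daddv_pi_add capEH vEH.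
      by rewrite (daddv_pi_id capHE vH) addrK subrr => ->; rewrite addr0.
    have fe : free [tuple e] by rewrite seq1_free.
    have := coord_free ord0 ord0 fe.
    by rewrite linearZ /= => ->; rewrite mulr1.
  pose w := (1 - c) *: e + a.
  have Lf_lin : linear (fun x => l x *: w).
    move=> k x y.
    have -> : l (k *: x + y) = k * l x + l y.
      by rewrite /l [P _]linearP [LHS]linearP.
    by rewrite scalerDl scalerA.
  pose Lf := GRing.isLinear.Build _ _ _ _ _ Lf_lin.
  pose Lw : {linear 'rV[C]_n.+1 -> 'rV[C]_n.+1} := HB.pack (fun x => l x *: w) Lf.
  pose L : 'End('rV[C]_n.+1) := (c *: \1 + linfun Lw)%VF.
  have LE t v : v \in H -> L (t *: e + v) = t *: e + (c *: v + t *: a).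
    move=> vH; rewrite add_lfunE scale_lfunE id_lfunE lfunE /= lE // /w.
    rewrite !scalerDr !scalerA mulrBr mulr1 scalerBl (mulrC t c).
    by rewrite addrACA subrKC.
  exists L; split.
    apply/eqP; rewrite -subv0; apply/subvP => x; rewrite memv_ker memv0 => /eqP.
    have [t [v [vH ->]]] := dec x; rewrite LE // => E.
    have t0 : t = 0.
      apply/eqP; apply: contraNT eH => t0; rewrite -(scalerK t0 e) memvZ //.
      move/eqP: E; rewrite addr_eq0 => /eqP ->.
      by rewrite rpredN rpredD ?memvZ.
    move: E; rewrite t0 !scale0r add0r addr0 add0r => /eqP.
    by rewrite scaler_eq0 (negbTE c0).
  move=> p.
  have [u u0 pE] : exists2 u, u != 0 & val p = <[u]>%VS.
    have p1 : \dim (val p) = 1%N by apply/eqP; exact: (valP p).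
    exists (vpick (val p)); first by rewrite vpick0 -dimv_eq0 p1.
    apply/esym/eqP; rewrite eqEdim -memvE memv_pick p1 dim_vline.
    by rewrite vpick0 -dimv_eq0 p1.
  have [t [v [vH uE]]] := dec u.
  case: (eqVneq t 0) => [t0|t0].
    rewrite gH; last by rewrite /pts /= pE -memvE uE t0 scale0r add0r.
    rewrite pE limg_line uE LE // t0 !scale0r !add0r addr0.
    apply/eqP; rewrite eqEsubv -!memvE memvZ ?memv_line // andbT.
    by rewrite -{1}(scalerK c0 v) memvZ ?memv_line.
  have lineZ (x : 'rV[C]_n.+1) : <[t *: x]>%VS = <[x]>%VS.
    apply/eqP; rewrite eqEsubv -!memvE memvZ ?memv_line //=.
    by rewrite -{1}(scalerK t0 x) memvZ ?memv_line.
  have uE' : u = t *: (e + t^-1 *: v) by rewrite scalerDr scalerA mulfV // scale1r.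
  rewrite (gE p (t^-1 *: v)) ?memvZ //; last by rewrite pE uE' lineZ.
  rewrite pE limg_line uE LE // -[LHS]lineZ !scalerDr !scalerA.
  by rewrite mulrAC mulfV // mul1r.
Qed.

(* Main.v *)
Require Import Defs.
From HB Require Import structures.
From mathcomp Require Import all_boot all_order all_algebra.
From mathcomp Require Import complex boolp classical_sets Rstruct.
From mathcomp Require Import reals topology normedtype derive.
From Stdlib Require Reals Lra ClassicalEpsilon.
From Coquelicot Require Rbar Hierarchy Lim_seq Continuity Derive RInt RInt_analysis
  ElemFct AutoDerive.

(** Write l for a linear form with kernel H.  A curve of degree 2 that is not
    contained in H meets H in a divisor of degree 2, so x0 and xoo are hit exactly
    once each, transversally, and nothing else of the curve lies in H.  After a
    Mobius change of parameter, x0 is hit at 0 and xoo at infinity.  Over C^* the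
    curve then avoids H, so it is z |-> [N(z)] for a unique N with l(N(z)) = 1, and
    Phi(z) = z N(z) is holomorphic on C^*.  The two zeros of l along the curve being
    simple, Phi extends holomorphically to 0 and Phi(z) / z^2 extends holomorphically
    to infinity, with values v0 and v1 on the lines x0 and xoo.  Hence, by a theorem
    of Liouville type, Phi(z) = v0 + z v + z^2 v1, where l(v) = 1; that is, the curve
    is the conic [u0 : u1] |-> [u0^2 v0 + u0 u1 v + u1^2 v1]
    (conic_of_lifts).  Scaling u0 and u1 by square roots turns v0 and v1 into fixed
    generators of the two lines (conic_normal_form), so two such curves differ only in
    the vector v, which is any vector outside H; the linear map that is the identity
    on H and takes one of these vectors to the other belongs to Aut(CP^n; H)
    (exists_shear).  Conversely every such conic has degree 2, because a linear form
    pulls back to a binary quadratic form, which is a product of two linear factors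
    (has_degree_conic).

    Liouville's theorem is obtained without power series or Cauchy's integral formula.
    Its core (limits_at_0_and_oo) says that a function holomorphic on C^* with a limit
    at 0 and a limit at infinity has the same limit at both ends: the integral of
    f(z) dz / z over the boundary of a square centred at 0 does not depend on the size
    of the square, and it tends to 2 pi i times either limit.  Independence is
    Goursat's theorem for a rectangle (goursat), proved by bisection for a real closed
    form whose coefficients are only assumed differentiable at every point.  Applied
    to the difference quotient of an entire function f at a point p, the core statement
    gives f'(p) = 0 as soon as f(z) = o(z) (sublinear_entire_const); subtracting a
    quadratic polynomial reduces an entire function with f(z) / z^2 holomorphic at
    infinity to this case (quadratic_entire). *)

(** * Goursat's theorem for closed forms in the plane *)

Module PlaneIntegrals.
Import Reals Lra ClassicalEpsilon Rcomplements Rbar Hierarchy Lim_seq Continuity Derive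
  RInt RInt_analysis ElemFct AutoDerive.
Local Open Scope R_scope.

(** Frechet differentiability at (x0, y0), with partial derivatives a and b; the
    coefficients of a form need not have continuous derivatives. *)
Definition diff2 (P : R -> R -> R) (x0 y0 a b : R) :=
  forall eps, 0 < eps -> exists delta, 0 < delta /\ forall x y,
    Rabs (x - x0) < delta -> Rabs (y - y0) < delta ->
    Rabs (P x y - P x0 y0 - a * (x - x0) - b * (y - y0))
      <= eps * (Rabs (x - x0) + Rabs (y - y0)).

Lemma diff2_continuous P x0 y0 a b : diff2 P x0 y0 a b ->
  forall eps, 0 < eps -> exists delta, 0 < delta /\ forall x y,
    Rabs (x - x0) < delta -> Rabs (y - y0) < delta ->
    Rabs (P x y - P x0 y0) < eps.
Proof.
(* Differentiability with error at most |x - x0| + |y - y0| makes P Lipschitz at the point,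
   with the constant k below (and room to spare). *)
move=> dP eps e0; have [d [d0 Hd]] := dP 1 Rlt_0_1.
pose k := 2 + Rabs a + Rabs b.
have k0 : 0 < k by rewrite /k; have := Rabs_pos a; have := Rabs_pos b; lra.
have ek : 0 < eps / (2 * k) by apply: Rdiv_lt_0_compat; lra.
exists (Rmin d (eps / (2 * k))); split; first exact: Rmin_pos.
move=> x y hx hy.
have := Hd x y (Rlt_le_trans _ _ _ hx (Rmin_l _ _)) (Rlt_le_trans _ _ _ hy (Rmin_l _ _)).
have {}hx := Rlt_le_trans _ _ _ hx (Rmin_r _ _).
have {}hy := Rlt_le_trans _ _ _ hy (Rmin_r _ _).
have ax := Rabs_mult a (x - x0); have bx := Rabs_mult b (y - y0).
have e1 : Rabs (x - x0) * k <= eps / 2.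
  replace (eps / 2) with (eps / (2 * k) * k) by (field; lra).
  apply: Rmult_le_compat_r; lra.
have e2 : Rabs (y - y0) * k < eps / 2.
  replace (eps / 2) with (eps / (2 * k) * k) by (field; lra).
  apply: Rmult_lt_compat_r; lra.
have pa := Rabs_pos a; have pb := Rabs_pos b.
have px := Rabs_pos (x - x0); have py := Rabs_pos (y - y0).
set s := P x y - P x0 y0 => hs.
have : Rabs s <= Rabs (s - a * (x - x0) - b * (y - y0)) + Rabs (a * (x - x0)) + Rabs (b * (y - y0)).
  apply: Rle_trans (Rplus_le_compat_r _ _ _ (Rabs_triang _ _)).
  apply: Rle_trans (Rabs_triang _ _); right; congr Rabs; ring.
have : 0 <= Rabs (x - x0) * Rabs b by apply: Rmult_le_pos.
have : 0 <= Rabs (y - y0) * Rabs a by apply: Rmult_le_pos.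
rewrite /k in e1 e2; rewrite ax bx; nra.
Qed.

Lemma diff2_section1 P x0 y0 a b :
  diff2 P x0 y0 a b -> continuous (fun x => P x y0) x0.
Proof.
move=> /diff2_continuous cP; apply/filterlim_locally => eps.
have [d [d0 Hd]] := cP eps (cond_pos eps).
exists (mkposreal d d0) => x /= hx; apply: Hd => //.
by rewrite Rminus_diag Rabs_R0.
Qed.

Lemma diff2_derive1 P x0 y0 a b :
  diff2 P x0 y0 a b -> is_derive (fun x => P x y0) x0 a.
Proof.
move=> dP; apply/is_derive_Reals => eps e0.
have [d [d0 Hd]] := dP (eps / 2) ltac:(lra).
exists (mkposreal d d0) => h h0 /= hd.
have := Hd (x0 + h) y0; rewrite Rminus_diag Rabs_R0.
have -> : x0 + h - x0 = h by ring.
move=> /(_ hd d0) H; have ah := Rabs_pos_lt _ h0.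
have -> : (P (x0 + h) y0 - P x0 y0) / h - a = (P (x0 + h) y0 - P x0 y0 - a * h - b * 0) / h.
  by field.
rewrite Rabs_div //; apply: (Rle_lt_trans _ (eps / 2)); last lra.
by apply/Rle_div_l => //; lra.
Qed.

Lemma diff2_swap P x0 y0 a b :
  diff2 P x0 y0 a b -> diff2 (fun y x => P x y) y0 x0 b a.
Proof.
move=> dP eps e0; have [d [d0 Hd]] := dP eps e0; exists d; split=> // y x hy hx.
have := Hd x y hx hy; rewrite Rplus_comm.
by have -> : P x y - P x0 y0 - a * (x - x0) - b * (y - y0) =
  P x y - P x0 y0 - b * (y - y0) - a * (x - x0) by ring.
Qed.

Lemma diff2_section2 P x0 y0 a b :
  diff2 P x0 y0 a b -> continuous (P x0) y0.
Proof. by move/diff2_swap; apply: diff2_section1. Qed.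

(** The mean value theorem along a horizontal and then a vertical segment. *)
Lemma diff2_zero_const P : (forall x y, diff2 P x y 0 0) ->
  forall x y x' y', P x y = P x' y'.
Proof.
move=> dP x y x' y'.
have horizontal Q : (forall x y, diff2 Q x y 0 0) -> forall u v w, Q u w = Q v w.
  move=> dQ u v w; have [||c [_]] := MVT_gen (fun t => Q t w) v u (fun _ => 0).
  - by move=> t _; apply: diff2_derive1 (dQ t w).
  - by move=> t _; apply/continuity_pt_filterlim; apply: diff2_section1 (dQ t w).
  by rewrite Rmult_0_l => E; lra.
rewrite (horizontal P dP x x').
by apply: (horizontal (fun y x => P x y)) => s t; apply/diff2_swap.
Qed.

(** The form P dx + Q dy is closed: the shared b is both dP/dy and dQ/dx. *)
Definition closed_form (P Q : R -> R -> R) x1 x2 y1 y2 :=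
  forall x y, x1 <= x <= x2 -> y1 <= y <= y2 ->
  exists a b c, diff2 P x y a b /\ diff2 Q x y b c.

(** The integral of P dx + Q dy along the boundary of the rectangle, counterclockwise. *)
Definition circulation (P Q : R -> R -> R) x1 x2 y1 y2 :=
  RInt (fun x => P x y1) x1 x2 + RInt (Q x2) y1 y2
  - RInt (fun x => P x y2) x1 x2 - RInt (Q x1) y1 y2.

Lemma closed_form_ex_RInt1 P Q x1 x2 y1 y2 a b y :
  closed_form P Q x1 x2 y1 y2 -> y1 <= y <= y2 ->
  x1 <= a -> a <= b -> b <= x2 -> ex_RInt (fun x => P x y) a b.
Proof.
move=> cPQ hy ha ab hb; apply: (@ex_RInt_continuous R_CompleteNormedModule) => z.
rewrite Rmin_left // Rmax_right // => hz.
have [|p [q [r [dP _]]]] := cPQ z y _ hy; first by lra.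
exact: diff2_section1 dP.
Qed.

Lemma closed_form_ex_RInt2 P Q x1 x2 y1 y2 a b x :
  closed_form P Q x1 x2 y1 y2 -> x1 <= x <= x2 ->
  y1 <= a -> a <= b -> b <= y2 -> ex_RInt (Q x) a b.
Proof.
move=> cPQ hx ha ab hb; apply: (@ex_RInt_continuous R_CompleteNormedModule) => z.
rewrite Rmin_left // Rmax_right // => hz.
have [|p [q [r [_ dQ]]]] := cPQ x z hx _; first by lra.
exact: diff2_section2 dQ.
Qed.

Lemma RInt_near_affine h (a b c d M : R) : a <= b -> ex_RInt h a b ->
  (forall t, a <= t <= b -> Rabs (h t - (c + d * t)) <= M) ->
  Rabs (RInt h a b - (c * (b - a) + d * (b ^ 2 - a ^ 2) / 2)) <= (b - a) * M.
Proof.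
move=> ab ih hM.
have iA : is_RInt (fun t => c + d * t) a b (c * (b - a) + d * (b ^ 2 - a ^ 2) / 2).
  have := @is_RInt_derive R_CompleteNormedModule (fun t => c * t + d * t ^ 2 / 2)
     (fun t => c + d * t) a b.
  rewrite /minus /plus /opp /=.
  set v := (X in is_RInt _ _ _ X); set w := (X in _ -> is_RInt _ _ _ X).
  have -> : v = w by rewrite /v /w; field.
  apply.
    by move=> t _; auto_derive => //; field.
  move=> t _; apply: (@ex_derive_continuous R_AbsRing R_NormedModule).
  by auto_derive.
rewrite -(is_RInt_unique _ _ _ _ iA).
have eA : ex_RInt (fun t => c + d * t) a b by exists (c * (b - a) + d * (b ^ 2 - a ^ 2) / 2).
have := RInt_minus _ _ _ _ ih eA; rewrite /minus /plus /opp /= => E.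
rewrite /Rminus -E.
apply: abs_RInt_le_const => //.
exact: (@ex_RInt_minus R_NormedModule) ih eA.
Qed.

(** Replacing P and Q by their first order expansions at (x0, y0) changes the
    circulation by a small multiple of perimeter times diameter, and the expansions,
    which make a closed form with affine coefficients, have circulation 0. *)
Lemma circulation_small P Q X1 X2 Y1 Y2 x0 y0 :
  closed_form P Q X1 X2 Y1 Y2 -> X1 <= x0 <= X2 -> Y1 <= y0 <= Y2 ->
  forall eps, 0 < eps -> exists delta, 0 < delta /\ forall x1 x2 y1 y2,
    X1 <= x1 -> x1 <= x0 <= x2 -> x2 <= X2 ->
    Y1 <= y1 -> y1 <= y0 <= y2 -> y2 <= Y2 ->
    x2 - x1 < delta -> y2 - y1 < delta ->
    Rabs (circulation P Q x1 x2 y1 y2) <= eps * ((x2 - x1) + (y2 - y1)) ^ 2.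
Proof.
move=> cPQ hx0 hy0 eps e0.
have [a [b [c [dP dQ]]]] := cPQ x0 y0 hx0 hy0.
have e2 : 0 < eps / 2 by lra.
have [dp [dp0 HP]] := dP _ e2; have [dq [dq0 HQ]] := dQ _ e2.
exists (Rmin dp dq); split; first exact: Rmin_pos.
move=> x1 x2 y1 y2 hX1 hx hX2 hY1 hy hY2.
move=> /Rmin_Rgt_l [wp wq] /Rmin_Rgt_l [vp vq].
pose s := (x2 - x1) + (y2 - y1).
have box x y : x1 <= x <= x2 -> y1 <= y <= y2 ->
    [/\ Rabs (x - x0) <= x2 - x1, Rabs (y - y0) <= y2 - y1 &
     Rabs (x - x0) + Rabs (y - y0) <= s].
  move=> hhx hhy.
  have ? : Rabs (x - x0) <= x2 - x1 by apply: Rabs_le; lra.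
  have ? : Rabs (y - y0) <= y2 - y1 by apply: Rabs_le; lra.
  by split=> //; rewrite /s; lra.
have bP x y : x1 <= x <= x2 -> y1 <= y <= y2 ->
    Rabs (P x y - P x0 y0 - a * (x - x0) - b * (y - y0)) <= eps / 2 * s.
  move=> hhx hhy; have [h1 h2 h3] := box x y hhx hhy.
  apply: Rle_trans (HP x y _ _) _; try lra.
  by apply: Rmult_le_compat_l; lra.
have bQ x y : x1 <= x <= x2 -> y1 <= y <= y2 ->
    Rabs (Q x y - Q x0 y0 - b * (x - x0) - c * (y - y0)) <= eps / 2 * s.
  move=> hhx hhy; have [h1 h2 h3] := box x y hhx hhy.
  apply: Rle_trans (HQ x y _ _) _; try lra.
  by apply: Rmult_le_compat_l; lra.
have x12 : x1 <= x2 by lra.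
have y12 : y1 <= y2 by lra.
have iP y : y1 <= y <= y2 -> Rabs (RInt (fun x => P x y) x1 x2
     - ((P x0 y0 - a * x0 + b * (y - y0)) * (x2 - x1) + a * (x2 ^ 2 - x1 ^ 2) / 2))
     <= (x2 - x1) * (eps / 2 * s).
  move=> hhy; apply: RInt_near_affine => //.
    by apply: (closed_form_ex_RInt1 _ _ _ _ _ _ _ _ _ cPQ) => //; lra.
  move=> t ht; apply: Rle_trans (bP t y ht hhy); right; congr Rabs; ring.
have iQ x : x1 <= x <= x2 -> Rabs (RInt (Q x) y1 y2
     - ((Q x0 y0 - c * y0 + b * (x - x0)) * (y2 - y1) + c * (y2 ^ 2 - y1 ^ 2) / 2))
     <= (y2 - y1) * (eps / 2 * s).
  move=> hhx; apply: RInt_near_affine => //.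
    by apply: (closed_form_ex_RInt2 _ _ _ _ _ _ _ _ _ cPQ) => //; lra.
  move=> t ht; apply: Rle_trans (bQ x t hhx ht); right; congr Rabs; ring.
have /Rabs_le_between E1 := iP y1 (conj (Rle_refl _) y12).
have /Rabs_le_between E2 := iP y2 (conj y12 (Rle_refl _)).
have /Rabs_le_between E3 := iQ x1 (conj (Rle_refl _) x12).
have /Rabs_le_between E4 := iQ x2 (conj x12 (Rle_refl _)).
rewrite /circulation; rewrite -/s.
have -> : eps * s ^ 2 = 2 * ((x2 - x1) * (eps / 2 * s)) + 2 * ((y2 - y1) * (eps / 2 * s)).
  by rewrite {1 3}/s /=; rewrite /s; field.
apply: Rabs_le; split; lra.
Qed.

(** Dyadic subdivision: c / 2 ^ n is the side of a rectangle after n halvings. *)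
Lemma half_width c n : c / 2 ^ n = c / 2 ^ n.+1 + c / 2 ^ n.+1.
Proof. by rewrite /=; field; apply: pow_nonzero; lra. Qed.

Lemma width_ge0 c n : 0 <= c -> 0 <= c / 2 ^ n.
Proof. by move=> c0; apply: Rdiv_le_0_compat => //; apply: pow_lt; lra. Qed.

(** The intervals [u n, u n + c / 2 ^ n] are nested; the supremum of their left ends
    lies in all of them. *)
Lemma nested_point (u : nat -> R) c : 0 <= c ->
  (forall n, u n <= u n.+1 <= u n + c / 2 ^ n.+1) ->
  exists l, forall n, u n <= l <= u n + c / 2 ^ n.
Proof.
move=> c0 hu.
have inc n k : u n <= u (addn n k).
  elim: k => [|k IH]; first by rewrite addn0; lra.
  by rewrite addnS; have := hu (addn n k); lra.
have dec n k : u (addn n k) + c / 2 ^ (addn n k) <= u n + c / 2 ^ n.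
  elim: k => [|k IH]; first by rewrite addn0; lra.
  by rewrite addnS; have := hu (addn n k); have := half_width c (addn n k); lra.
have up n m : u n <= u m + c / 2 ^ m.
  have := width_ge0 c (maxn n m) c0.
  have := inc n (subn m n); have := dec m (subn n m).
  by rewrite -!maxnE maxnC; lra.
have [||l [ub lub]] := completeness (fun x => exists n, x = u n).
- by exists (u O + c / 2 ^ 0) => _ [n ->].
- by exists (u O); exists O.
exists l => n; split; first by apply: ub; exists n.
by apply: lub => _ [m ->].
Qed.

(** A property of rectangles that follows from the same property of the four quarters,
    and that holds for all small dyadic rectangles around each point, holds for the whole
    rectangle: otherwise bad rectangles would shrink to a point.  Good n x y is about
    the rectangle with lower left corner (x, y) and sides a / 2 ^ n and b / 2 ^ n. *)
Lemma bisection (X Y a b : R) (Good : nat -> R -> R -> Prop) : 0 <= a -> 0 <= b ->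
  (forall n x y, Good n.+1 x y -> Good n.+1 (x + a / 2 ^ n.+1) y ->
    Good n.+1 x (y + b / 2 ^ n.+1) -> Good n.+1 (x + a / 2 ^ n.+1) (y + b / 2 ^ n.+1) ->
    Good n x y) ->
  (forall x0 y0, X <= x0 <= X + a -> Y <= y0 <= Y + b ->
    exists N, forall n x y, (N <= n)%coq_nat ->
      x <= x0 <= x + a / 2 ^ n -> y <= y0 <= y + b / 2 ^ n -> Good n x y) ->
  Good O X Y.
Proof.
move=> a0 b0 Good_split Good_local; apply: Classical_Prop.NNPP => nG.
pose child n (p q : R * R) := [/\ ~ Good n.+1 q.1 q.2,
  p.1 <= q.1 <= p.1 + a / 2 ^ n.+1 & p.2 <= q.2 <= p.2 + b / 2 ^ n.+1].
have child_ex n p : ~ Good n p.1 p.2 -> exists q, child n p q.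
  move=> nGp; have ha := width_ge0 a n.+1 a0; have hb := width_ge0 b n.+1 b0.
  apply: Classical_Prop.NNPP => nex; apply: nGp.
  have good q : p.1 <= q.1 <= p.1 + a / 2 ^ n.+1 -> p.2 <= q.2 <= p.2 + b / 2 ^ n.+1 ->
      Good n.+1 q.1 q.2.
    by move=> h1 h2; apply: Classical_Prop.NNPP => nGq; apply: nex; exists q.
  apply: Good_split.
  - by apply: (good p); lra.
  - by apply: (good (p.1 + a / 2 ^ n.+1, p.2)); cbn [fst snd]; lra.
  - by apply: (good (p.1, p.2 + b / 2 ^ n.+1)); cbn [fst snd]; lra.
  - by apply: (good (p.1 + a / 2 ^ n.+1, p.2 + b / 2 ^ n.+1)); cbn [fst snd]; lra.
pose corner := nat_rect (fun=> (R * R)%type) (X, Y)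
  (fun n p => epsilon (inhabits p) (child n p)).
have bad n : ~ Good n (corner n).1 (corner n).2 /\ child n (corner n) (corner n.+1).
  elim: n => [|n [_ [IH _ _]]].
    by split=> //; apply: epsilon_spec; apply: child_ex.
  by split=> //; apply: epsilon_spec; apply: child_ex.
have [x0 hx0] : exists l, forall n, (corner n).1 <= l <= (corner n).1 + a / 2 ^ n.
  by apply: (nested_point (fun n => (corner n).1)) => // n; have [_ []] := bad n.
have [y0 hy0] : exists l, forall n, (corner n).2 <= l <= (corner n).2 + b / 2 ^ n.
  by apply: (nested_point (fun n => (corner n).2)) => // n; have [_ []] := bad n.
have [||N HN] := Good_local x0 y0.
- by have := hx0 O; rewrite /= Rdiv_1_r.
- by have := hy0 O; rewrite /= Rdiv_1_r.
by have [] := bad N; case; apply: HN.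
Qed.

Lemma pow2_small c d : 0 < d -> exists N, forall n, (N <= n)%coq_nat -> c / 2 ^ n < d.
Proof.
move=> d0; have := is_lim_seq_geom (/ 2) ltac:(rewrite Rabs_pos_eq; lra).
have c1 : 0 < d / (Rabs c + 1) by apply: Rdiv_lt_0_compat => //; have := Rabs_pos c; lra.
move=> /is_lim_seq_spec /(_ (mkposreal _ c1)) [N HN]; exists N => n /HN /=.
rewrite Rminus_0_r pow_inv.
have p2 : 0 < / 2 ^ n by apply: Rinv_0_lt_compat; apply: pow_lt; lra.
rewrite Rabs_pos_eq; last lra.
move=> /(Rmult_lt_compat_l (Rabs c + 1) _ _ ltac:(have := Rabs_pos c; lra)).
have -> : (Rabs c + 1) * (d / (Rabs c + 1)) = d by field; have := Rabs_pos c; lra.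
apply: Rle_lt_trans; apply: Rmult_le_compat_r; first lra.
by have := Rle_abs c; lra.
Qed.

(** Bisection of the bound |circulation| <= eps (width + height)^2: the circulation is
    additive over the four quarters while the bound is divided by 4 for each of them. *)
Theorem goursat P Q x1 x2 y1 y2 : x1 <= x2 -> y1 <= y2 ->
  closed_form P Q x1 x2 y1 y2 -> circulation P Q x1 x2 y1 y2 = 0.
Proof.
move=> x12 y12 cPQ.
pose a := x2 - x1; pose b := y2 - y1.
have a0 : 0 <= a by rewrite /a; lra.
have b0 : 0 <= b by rewrite /b; lra.
suff key eps : 0 < eps -> Rabs (circulation P Q x1 x2 y1 y2) <= eps * (a + b) ^ 2.
  apply: cond_eq => d d0; rewrite Rminus_0_r.
  have s0 : 0 <= (a + b) ^ 2 by apply: pow2_ge_0.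
  have e0 : 0 < d / ((a + b) ^ 2 + 1) by apply: Rdiv_lt_0_compat; lra.
  apply: Rle_lt_trans (key _ e0) _.
  apply: (Rlt_le_trans _ (d / ((a + b) ^ 2 + 1) * ((a + b) ^ 2 + 1))).
    by apply: Rmult_lt_compat_l; lra.
  by right; field; lra.
move=> e0.
(* The bounds on x and y keep the rectangle inside the domain of the form. *)
pose Good n x y := x1 <= x -> x + a / 2 ^ n <= x2 -> y1 <= y -> y + b / 2 ^ n <= y2 ->
  Rabs (circulation P Q x (x + a / 2 ^ n) y (y + b / 2 ^ n)) <= eps * (a / 2 ^ n + b / 2 ^ n) ^ 2.
suff: Good O x1 y1.
  have e1 : x1 + a / 2 ^ 0 = x2 by rewrite /a /=; field.
  have e2 : y1 + b / 2 ^ 0 = y2 by rewrite /b /=; field.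
  by rewrite /Good e1 e2 => G; apply: Rle_trans (G _ _ _ _) _; try lra; rewrite /= !Rdiv_1_r; lra.
apply: (bisection x1 y1 a b Good a0 b0).
- move=> n x y; rewrite /Good (half_width a n) (half_width b n).
  have := width_ge0 a n.+1 a0; have := width_ge0 b n.+1 b0.
  set a' := a / 2 ^ n.+1; set b' := b / 2 ^ n.+1 => hb ha G1 G2 G3 G4 h1 h2 h3 h4.
  have {}G1 := G1 ltac:(lra) ltac:(lra) ltac:(lra) ltac:(lra).
  have {}G2 := G2 ltac:(lra) ltac:(lra) ltac:(lra) ltac:(lra).
  have {}G3 := G3 ltac:(lra) ltac:(lra) ltac:(lra) ltac:(lra).
  have {}G4 := G4 ltac:(lra) ltac:(lra) ltac:(lra) ltac:(lra).
  rewrite -!Rplus_assoc.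
  have -> : circulation P Q x (x + a' + a') y (y + b' + b') =
     circulation P Q x (x + a') y (y + b') + circulation P Q (x + a') (x + a' + a') y (y + b')
     + circulation P Q x (x + a') (y + b') (y + b' + b')
     + circulation P Q (x + a') (x + a' + a') (y + b') (y + b' + b').
    rewrite /circulation.
    have CP z : y1 <= z <= y2 -> RInt (fun t => P t z) x (x + a' + a') =
       RInt (fun t => P t z) x (x + a') + RInt (fun t => P t z) (x + a') (x + a' + a').
      move=> hz; symmetry; apply: RInt_Chasles;
        apply: (closed_form_ex_RInt1 _ _ _ _ _ _ _ _ _ cPQ) => //; lra.
    have CQ z : x1 <= z <= x2 -> RInt (Q z) y (y + b' + b') =
       RInt (Q z) y (y + b') + RInt (Q z) (y + b') (y + b' + b').
      move=> hz; symmetry; apply: RInt_Chasles;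
        apply: (closed_form_ex_RInt2 _ _ _ _ _ _ _ _ _ cPQ) => //; lra.
    by rewrite !CP ?CQ; lra.
  move: G1 G2 G3 G4 => /Rabs_le_between G1 /Rabs_le_between G2 /Rabs_le_between G3 /Rabs_le_between G4.
  apply: Rabs_le.
  have -> : (a' + a' + b' + b') ^ 2 = 4 * (a' + b') ^ 2 by ring.
  by lra.
- move=> x0 y0 hx0 hy0.
  have [||d [d0 Hd]] := circulation_small _ _ _ _ _ _ x0 y0 cPQ _ _ _ e0.
  + by rewrite /a in hx0; lra.
  + by rewrite /b in hy0; lra.
  have [N HN] := pow2_small a d d0; have [N' HN'] := pow2_small b d d0.
  exists (N + N')%coq_nat => n x y hn hx hy h1 h2 h3 h4.
  have := Hd x (x + a / 2 ^ n) y (y + b / 2 ^ n).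
  have -> : x + a / 2 ^ n - x = a / 2 ^ n by ring.
  have -> : y + b / 2 ^ n - y = b / 2 ^ n by ring.
  apply=> //.
  + by apply: HN; apply: PeanoNat.Nat.le_trans hn; apply: PeanoNat.Nat.le_add_r.
  + by apply: HN'; apply: PeanoNat.Nat.le_trans hn; rewrite PeanoNat.Nat.add_comm; apply: PeanoNat.Nat.le_add_r.
Qed.

(** The functions U and V are the real and imaginary parts of a function whose complex
    derivative at x + iy is a - ib. *)
Definition cauchy_riemann (U V : R -> R -> R) x y :=
  exists a b, diff2 U x y a b /\ diff2 V x y (- b) a.

(** Let f = U + iV; the symmetry hypotheses say that f(iz) = -i f(z), so that f(z) dz is
    invariant under quarter turns.  Then RInt (U r) (- r) r is a quarter of the imaginary
    part of the integral of f(z) dz around the square with vertices (+-r, +-r).  The region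
    between the squares of sizes r and s is a pinwheel of four rectangles, the rotations of
    [r, s] x [-r, s]; the quarter turns move the sides of this single rectangle onto the
    right sides of the two squares. *)
Lemma side_integral_const U V :
  (forall x y, 0 < x ^ 2 + y ^ 2 -> cauchy_riemann U V x y) ->
  (forall x y, U (- y) x = V x y) -> (forall x y, V (- y) x = - U x y) ->
  forall r s, 0 < r -> r <= s -> RInt (U r) (- r) r = RInt (U s) (- s) s.
Proof.
move=> CR UV VU r s r0 rs.
have cf : closed_form V U r s (- r) s.
  move=> x y hx hy; have [|a [b [dU dV]]] := CR x y.
    by have := pow2_ge_0 y; have := pow_lt x 2; lra.
  by exists (- b), a, b; split.
have rs' : - r <= s by lra.
have := goursat _ _ _ _ _ _ rs rs' cf; rewrite /circulation.
have cU x y : 0 < x -> continuous (U x) y.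
  move=> x0; have [|a [b [dU _]]] := CR x y; first by have := pow2_ge_0 y; have := pow_lt x 2; lra.
  exact: diff2_section2 dU.
have iU x a b : 0 < x -> ex_RInt (U x) a b.
  by move=> x0; apply: (@ex_RInt_continuous R_CompleteNormedModule) => z _; apply: cU.
have s0 : 0 < s by lra.
have -> : RInt (fun x => V x (- r)) r s = RInt (U r) r s.
  apply: RInt_ext => x _.
  by rewrite -UV Ropp_involutive.
have -> : RInt (fun x => V x s) r s = - RInt (U s) (- s) (- r).
  have /(RInt_correct (V := R_CompleteNormedModule)) h := iU s (- r) (- s) s0.
  have /is_RInt_unique h' := is_RInt_comp_opp _ _ _ _ h.
  have -> : - RInt (U s) (- s) (- r) = RInt (U s) (- r) (- s).
    by apply: (@opp_RInt_swap R_CompleteNormedModule); apply: iU.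
  rewrite -h'; apply: RInt_ext => x _; rewrite /opp /=.
  by rewrite -VU Ropp_involutive.
have C1 := RInt_Chasles (U r) (- r) r s (iU _ _ _ r0) (iU _ _ _ r0).
have C2 := RInt_Chasles (U s) (- s) (- r) s (iU _ _ _ s0) (iU _ _ _ s0).
rewrite /plus /= in C1 C2; lra.
Qed.


(** The case f(z) = (a + ib) / z of the side integral. *)
Lemma side_integral_inverse r a b : 0 < r ->
  is_RInt (fun y => (a * r + b * y) / (r ^ 2 + y ^ 2)) (- r) r (a * (PI / 2)).
Proof.
move=> r0.
have pos y : 0 < r ^ 2 + y ^ 2 by have := pow2_ge_0 y; have := pow_lt r 2 r0; lra.
have := @is_RInt_derive R_CompleteNormedModule
   (fun y => a * atan (y / r) + b / 2 * ln (r ^ 2 + y ^ 2))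
   (fun y => (a * r + b * y) / (r ^ 2 + y ^ 2)) (- r) r.
rewrite /minus /plus /opp /=.
have -> : - r / r = - 1 by field; lra.
have -> : r / r = 1 by field; lra.
have -> : - r * (- r * 1) = r * (r * 1) by ring.
rewrite atan_opp atan_1.
set v := (X in is_RInt _ _ _ X); set w := (X in _ -> is_RInt _ _ _ X).
have -> : v = w by rewrite /v /w; field.
apply=> y _; have py := pos y; rewrite /= in py.
  auto_derive; first by lra.
  by field; split; [nra | lra].
apply: (@ex_derive_continuous R_AbsRing R_NormedModule).
by auto_derive; lra.
Qed.

Lemma side_integral_near U r a b eta : 0 < r -> ex_RInt (U r) (- r) r ->
  (forall y, Rabs y <= r -> Rabs (U r y - (a * r + b * y) / (r ^ 2 + y ^ 2)) <= eta / r) ->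
  Rabs (RInt (U r) (- r) r - a * (PI / 2)) <= 2 * eta.
Proof.
move=> r0 iU near.
have iI := side_integral_inverse r a b r0.
have eI : ex_RInt (fun y => (a * r + b * y) / (r ^ 2 + y ^ 2)) (- r) r by eexists; exact: iI.
have := RInt_minus _ _ _ _ iU eI; rewrite (is_RInt_unique _ _ _ _ iI) /minus /plus /opp /= => E.
rewrite /Rminus -E.
have -> : 2 * eta = (r - - r) * (eta / r) by field; lra.
apply: abs_RInt_le_const; first lra.
  exact: (@ex_RInt_minus R_NormedModule) iU eI.
by move=> y hy; apply: near; apply: Rabs_le.
Qed.

(** Let f = U + iV.  If f(z) is asymptotic to (a + ib) / z at 0 and to (a' + ib') / z at
    infinity, the constant side integral is close to a pi / 2 for small squares and to
    a' pi / 2 for large ones. *)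
Theorem simple_pole_residues U V a b a' b' :
  (forall x y, 0 < x ^ 2 + y ^ 2 -> cauchy_riemann U V x y) ->
  (forall x y, U (- y) x = V x y) -> (forall x y, V (- y) x = - U x y) ->
  (forall eta, 0 < eta -> exists delta, 0 < delta /\ forall x y,
     0 < x -> x < delta -> Rabs y <= x ->
     Rabs (U x y - (a * x + b * y) / (x ^ 2 + y ^ 2)) <= eta / x) ->
  (forall eta, 0 < eta -> exists M, forall x y,
     0 < x -> M < x -> Rabs y <= x ->
     Rabs (U x y - (a' * x + b' * y) / (x ^ 2 + y ^ 2)) <= eta / x) ->
  a = a'.
Proof.
move=> CR UV VU at0 atoo; apply: cond_eq => d d0.
have [delta [de0 near0]] := at0 (d / 4) ltac:(lra).
have [M nearoo] := atoo (d / 4) ltac:(lra).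
pose r := delta / 2; pose s := Rmax (M + 1) r.
have r0 : 0 < r by rewrite /r; lra.
have rs : r <= s by apply: Rmax_r.
have Ms : M < s by apply: Rlt_le_trans (Rmax_l _ _); lra.
have iU x c e : 0 < x -> ex_RInt (U x) c e.
  move=> x0; apply: (@ex_RInt_continuous R_CompleteNormedModule) => y _.
  have [|p [q [dU _]]] := CR x y; first by have := pow2_ge_0 y; have := pow_lt x 2; lra.
  exact: diff2_section2 dU.
have Nr : Rabs (RInt (U r) (- r) r - a * (PI / 2)) <= 2 * (d / 4).
  apply: (side_integral_near U r a b) => //; first exact: iU.
  by move=> y hy; apply: near0 => //; rewrite /r; lra.
have Ns : Rabs (RInt (U s) (- s) s - a' * (PI / 2)) <= 2 * (d / 4).
  apply: (side_integral_near U s a' b'); [lra | apply: iU; lra |].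
  by move=> y hy; apply: nearoo => //; lra.
rewrite -(side_integral_const U V CR UV VU r s r0 rs) in Ns.
move/Rabs_le_between: Nr; move/Rabs_le_between: Ns => Ns Nr.
have P1 : 1 < PI / 2 by have := PI2_1.
have : Rabs (a - a') * (PI / 2) <= d.
  rewrite -(Rabs_pos_eq (PI / 2)); last lra.
  rewrite -Rabs_mult; apply: Rabs_le; lra.
have := Rabs_pos (a - a'); nra.
Qed.
End PlaneIntegrals.

From mathcomp Require Import zify ring lra.

Set Implicit Arguments.
Unset Strict Implicit.
Unset Printing Implicit Defensive.

Import Order.TTheory GRing.Theory Num.Theory.
Import numFieldNormedType.Exports.
Local Open Scope ring_scope.
Local Open Scope classical_set_scope.

Local Notation R := Rdefinitions.R.

(** * Holomorphic functions of one variable *)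

(** A record rather than an abbreviation: the unfolding of derivable to a convergence
    statement confuses unification and the inference of implicit arguments. *)
Record holomorphic_at (f : C -> C) (z : C) : Prop :=
  HolomorphicAt { holomorphic_at_derivable : derivable (f : C^o -> C^o) z 1 }.

Lemma holomorphic_at_cst (c z : C) : holomorphic_at (fun=> c) z.
Proof. by split; exact: derivable_cst. Qed.

Lemma holomorphic_at_id z : holomorphic_at id z.
Proof. by split; exact: derivable_id. Qed.

Lemma holomorphic_atD (f g : C -> C) z : holomorphic_at f z -> holomorphic_at g z ->
  holomorphic_at (fun w => f w + g w) z.
Proof. by move=> [df] [dg]; split; exact: (derivableD df dg). Qed.

Lemma holomorphic_atB (f g : C -> C) z : holomorphic_at f z -> holomorphic_at g z ->
  holomorphic_at (fun w => f w - g w) z.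
Proof. by move=> [df] [dg]; split; exact: (derivableB df dg). Qed.

Lemma holomorphic_atM (f g : C -> C) z : holomorphic_at f z -> holomorphic_at g z ->
  holomorphic_at (fun w => f w * g w) z.
Proof. by move=> [df] [dg]; split; exact: (derivableM df dg). Qed.

Lemma holomorphic_atV (f : C -> C) z : f z != 0 -> holomorphic_at f z ->
  holomorphic_at (fun w => (f w)^-1) z.
Proof.
by move=> fz [df]; split; exact: (derivableV (fz : (f : C^o -> C^o) z != 0) df).
Qed.

Lemma holomorphic_atX (f : C -> C) z d :
  holomorphic_at f z -> holomorphic_at (fun w => f w ^+ d) z.
Proof.
move=> df; elim: d => [|d IHd]; first exact: holomorphic_at_cst.
rewrite (_ : (fun w => _) = fun w => f w * f w ^+ d); first exact: holomorphic_atM.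
by apply/funext => w; rewrite exprS.
Qed.

Lemma holomorphic_at_comp (f g : C -> C) (z : C) :
  holomorphic_at g z -> holomorphic_at f (g z) -> holomorphic_at (fun w => f (g w)) z.
Proof.
move=> [/derivable1_diffP dg] [/derivable1_diffP df].
by split; apply/derivable1_diffP; exact: (differentiable_comp dg df).
Qed.

Lemma holomorphic_at_near (f g : C -> C) (z : C) :
  (\forall w \near (z : C^o), f w = g w) -> holomorphic_at f z -> holomorphic_at g z.
Proof.
move=> fg [df]; split.
exact: (@near_eq_derivable _ C^o C^o f g z 1 fg df).
Qed.

Lemma norm_complex_le (x y : R) : `|(x +i* y)%C| <= (`|x| + `|y|)%:C%C.
Proof.
have -> : (x +i* y)%C = x%:C%C + 'i%C * y%:C%C by simpc.
apply: le_trans (ler_normD _ _) _; rewrite normrM.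
have n r : `|r%:C%C| = `|r|%:C%C :> C by rewrite normc_def /= expr0n addr0 sqrtr_sqr.
by rewrite !n normc_def /= expr0n expr1n add0r sqrtr1 mul1r rmorphD.
Qed.

Lemma Re_norm_le (z : C) (e : R) : `|z| <= e%:C%C -> `|complex.Re z| <= e.
Proof.
rewrite normc_def lecR => le_e; apply: le_trans le_e.
by rewrite -sqrtr_sqr ler_wsqrtr // lerDl sqr_ge0.
Qed.

Lemma Im_norm_le (z : C) (e : R) : `|z| <= e%:C%C -> `|complex.Im z| <= e.
Proof.
rewrite normc_def lecR => le_e; apply: le_trans le_e.
by rewrite -sqrtr_sqr ler_wsqrtr // lerDr sqr_ge0.
Qed.

(** Neighbourhoods in C are defined by radii that are positive complex numbers; such a
    radius is real. *)
Lemma near_disk (z : C^o) (P : C^o -> Prop) : (\forall w \near z, P w) <->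
  exists2 d : R, 0 < d & forall w : C, `|w - z| < d%:C%C -> P w.
Proof.
split=> [/nbhs_normP [[e1 e2] /=]|[d d0 H]].
  rewrite ltcE /= => /andP[/eqP -> e0] H; exists e1 => // w wz.
  by apply: H; rewrite /= distrC.
apply/nbhs_normP; exists d%:C%C; first by rewrite /= ltcR.
by move=> w /=; rewrite distrC; exact: H.
Qed.

Lemma near_punctured_disk (z : C^o) (P : C^o -> Prop) : (\forall w \near z^', P w) <->
  exists2 d : R, 0 < d & forall w : C, w != z -> `|w - z| < d%:C%C -> P w.
Proof.
rewrite near_withinE; apply: (iff_trans (near_disk _ _)).
by split=> -[d d0 H]; exists d => // w; [move=> wnz wz; exact: H | move=> wz wnz; exact: H].
Qed.

Lemma near_complex (z : C^o) (P : C^o -> Prop) : (\forall w \near z, P w) ->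
  exists2 d : R, 0 < d & forall x y, `|x - complex.Re z| < d ->
    `|y - complex.Im z| < d -> P (x +i* y)%C.
Proof.
move=> /near_disk [e e0 H].
exists (e / 2) => [|x y hx hy]; first by rewrite divr_gt0.
apply: H; case: z hx hy => a b /= hx hy.
rewrite -[_ - _]/((x - a) +i* (y - b))%C.
apply: le_lt_trans (norm_complex_le _ _) _.
by rewrite ltcR [ltRHS]splitr ltrD.
Qed.

Definition complex_derivative (f : C -> C) (z c : C) :=
  (fun h : C^o => (f (h + z) - f z) / h : C^o) @ (0 : C^o)^' --> (c : C^o).

Lemma holomorphic_at_derivative (f : C -> C) (z : C) :
  holomorphic_at f z -> exists c, complex_derivative f z c.
Proof.
move=> [/cvg_ex [c cvgf]]; exists c; apply: cvg_trans cvgf.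
apply: near_eq_cvg; apply: nearW => h /=.
by rewrite [_%:A]mulr1 [LHS]mulrC.
Qed.

Lemma complex_derivative_expansion (f : C -> C) (z c : C) : complex_derivative f z c ->
  forall e : R, 0 < e ->
  \forall w \near (z : C^o), `|f w - f z - c * (w - z)| <= e%:C%C * `|w - z|.
Proof.
move=> /cvgrPdist_le cvgf e e0.
have e0C : 0 < e%:C%C :> C by rewrite ltcR.
have /near_punctured_disk [d d0 H] := cvgf _ e0C.
apply/near_disk; exists d => // w wz.
case: (eqVneq w z) => [->|wnz]; first by rewrite !subrr mulr0 subr0 normr0 mulr0.
have h0 : w - z != 0 by rewrite subr_eq0.
have := H (w - z) h0; rewrite subr0 => /(_ wz); rewrite subrK => le_e.
rewrite -ler_pdivrMr ?normr_gt0 // -normfV -normrM; apply: le_trans le_e.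
by rewrite distrC mulrBl mulfK.
Qed.

(** Multiplication by c = p + iq is the real linear map with matrix (p, -q; q, p), which
    is where the Cauchy-Riemann relations come from. *)
Lemma complex_derivative_diff2 (f : C -> C) (x y : R) (c : C) :
  complex_derivative f (x +i* y)%C c ->
  PlaneIntegrals.diff2 (fun x y => complex.Re (f (x +i* y)%C)) x y
    (complex.Re c) (- complex.Im c) /\
  PlaneIntegrals.diff2 (fun x y => complex.Im (f (x +i* y)%C)) x y
    (complex.Im c) (complex.Re c).
Proof.
case: c => a b /complex_derivative_expansion df.
suff key (F : C -> R) p q : (forall z w : C, F (z - w) = F z - F w) ->
    (forall (z : C) e, `|z| <= e%:C%C -> `|F z| <= e) ->
    (forall s t : R, F ((a +i* b) * (s +i* t))%C = p * s + q * t) ->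
    PlaneIntegrals.diff2 (fun x y => F (f (x +i* y)%C)) x y p q.
  split; apply: key.
  - by move=> [? ?] [? ?].
  - exact: Re_norm_le.
  - by move=> s t /=; rewrite mulNr.
  - by move=> [? ?] [? ?].
  - exact: Im_norm_le.
  - by move=> s t /=; rewrite addrC.
move=> FB Fle FM eps /RltP e0.
have [d d0 H] := near_complex (df eps e0).
exists d; split; first exact/RltP.
move=> x' y' /RltP + /RltP; rewrite !RabsE !RminusE !RmultE !RplusE => hx hy.
apply/RleP; have {hx hy} /= := H x' y' hx hy.
rewrite -[(x' +i* y' - x +i* y)%C]/((x' - x) +i* (y' - y))%C => H1.
have : `|f (x' +i* y')%C - f (x +i* y)%C - (a +i* b)%C * ((x' - x) +i* (y' - y))%C|
     <= (eps * (`|x' - x| + `|y' - y|))%:C%C.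
  apply: le_trans H1 _; rewrite rmorphM ler_wpM2l ?norm_complex_le //.
  by rewrite lecR ltW.
move=> /Fle; rewrite !FB FM; congr (`|_| <= _).
by rewrite opprD addrA.
Qed.

Lemma holomorphic_at_cauchy_riemann (f : C -> C) (x y : R) : holomorphic_at f (x +i* y)%C ->
  PlaneIntegrals.cauchy_riemann (fun x y => complex.Re (f (x +i* y)%C))
    (fun x y => complex.Im (f (x +i* y)%C)) x y.
Proof.
move=> /holomorphic_at_derivative [c /complex_derivative_diff2 [dU dV]].
by exists (complex.Re c), (- complex.Im c); rewrite RoppE opprK.
Qed.

(** * Holomorphic functions on the punctured plane *)

Lemma cvg_rotate (f : C -> C) (u A : C) : `|u| = 1 ->
  (f : C^o -> C^o) @ (0 : C^o)^' --> (A : C^o) ->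
  (fun z : C^o => f (u * z) : C^o) @ (0 : C^o)^' --> (A : C^o).
Proof.
move=> u1 /cvgrPdist_lt cvgf; apply/cvgrPdist_lt => e e0.
have /near_punctured_disk [d d0 H] := cvgf _ e0.
apply/near_punctured_disk; exists d => // z z0 zd; apply: H.
  by rewrite mulf_neq0 // -normr_eq0 u1 oner_eq0.
by move: zd; rewrite !subr0 normrM u1 mul1r.
Qed.

(** Averaging f over the quarter turns (up to the factor 4): dividing the sum by z
    gives a function g with g(iz) = -i g(z), to which the integral over a square is adapted. *)
Definition quarter_turn_sum (f : C -> C) (z : C) : C :=
  f z + f ('i%C * z) + f (- 1 * z) + f (- 'i%C * z).

Lemma norm_i : `|'i%C : C| = 1.
Proof. by rewrite normc_def /= expr0n add0r expr1n sqrtr1. Qed.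

Lemma inv_i : ('i%C : C)^-1 = - 'i%C.
Proof.
have i0 : 'i%C != 0 :> C by rewrite -normr_eq0 norm_i oner_eq0.
by apply: (mulfI i0); rewrite mulfV // mulrN -expr2 sqr_i opprK.
Qed.

Lemma cvg_quarter_turn_sum (f : C -> C) (A : C) :
  (f : C^o -> C^o) @ (0 : C^o)^' --> (A : C^o) ->
  (quarter_turn_sum f : C^o -> C^o) @ (0 : C^o)^' --> (A + A + A + A : C^o).
Proof.
move=> cvgf.
apply: cvgD; last by apply: cvg_rotate => //; rewrite normrN norm_i.
apply: cvgD; last by apply: cvg_rotate => //; rewrite normrN1.
by apply: cvgD => //; apply: cvg_rotate => //; rewrite norm_i.
Qed.

Lemma quarter_turn_sum_inv (f : C -> C) z :
  quarter_turn_sum f z^-1 = quarter_turn_sum (fun w => f w^-1) z.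
Proof.
rewrite /quarter_turn_sum !invfM invrN1 invrN inv_i opprK.
by rewrite [LHS]addrAC (addrAC (f z^-1) (f (_ / z))) [LHS]addrAC.
Qed.

Lemma quarter_turn_sumE (f : C -> C) z :
  quarter_turn_sum f ('i%C * z) = quarter_turn_sum f z.
Proof.
rewrite /quarter_turn_sum !mulrA !mulNr !mul1r -expr2 sqr_i !mulNr !mul1r opprK.
by rewrite addrC !addrA.
Qed.

Lemma holomorphic_at_quarter_turn_sum (f : C -> C) (z : C) :
  (forall w, w != 0 -> holomorphic_at f w) -> z != 0 ->
  holomorphic_at (quarter_turn_sum f) z.
Proof.
move=> df z0.
have dr (u : C) : `|u| = 1 -> holomorphic_at (fun z => f (u * z)) z.
  move=> u1; apply: (@holomorphic_at_comp f (fun z => u * z)).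
    by apply: holomorphic_atM; [exact: holomorphic_at_cst | exact: holomorphic_at_id].
  by apply: df; rewrite mulf_neq0 // -normr_eq0 u1 oner_eq0.
apply: holomorphic_atD; last by apply: dr; rewrite normrN norm_i.
apply: holomorphic_atD; last by apply: dr; rewrite normrN1.
by apply: holomorphic_atD; [exact: df | apply: dr; rewrite norm_i].
Qed.

(** The fraction on the left is the real part of A / (x + iy). *)
Lemma simple_pole_estimate (s A : C) (x y eta : R) : 0 < x ->
  `|s - A| <= eta%:C%C ->
  `|complex.Re (s / (x +i* y)%C) -
     (complex.Re A * x + complex.Im A * y) / (x ^+ 2 + y ^+ 2)| <= eta / x.
Proof.
move=> x0 sA.
have -> : (complex.Re A * x + complex.Im A * y) / (x ^+ 2 + y ^+ 2)
    = complex.Re (A / (x +i* y)%C).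
  by case: A {sA} => a b /=; rewrite mulrN opprK mulrDl !mulrA.
have -> : complex.Re (s / (x +i* y)%C) - complex.Re (A / (x +i* y)%C)
    = complex.Re ((s - A) / (x +i* y)%C).
  by rewrite mulrBl; case: (s / _) (A / _) => [? ?] [].
apply: Re_norm_le; rewrite normrM normfV rmorphM /= fmorphV.
have xz : x%:C%C <= `|(x +i* y)%C : C|.
  rewrite normc_def lecR /= -{1}(ger0_norm (ltW x0)) -sqrtr_sqr.
  by rewrite ler_wsqrtr // lerDl sqr_ge0.
have x0C : 0 < x%:C%C :> C by rewrite ltcR.
have z0 : 0 < `|(x +i* y)%C : C| by exact: lt_le_trans xz.
by rewrite ler_pM ?invr_ge0 ?lef_pV2 ?posrE //; exact: ltW.
Qed.

Lemma Re_limits_at_0_and_oo (f : C -> C) (A B : C) :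
  (forall z, z != 0 -> holomorphic_at f z) ->
  (f : C^o -> C^o) @ (0 : C^o)^' --> (A : C^o) ->
  (fun w : C^o => f w^-1 : C^o) @ (0 : C^o)^' --> (B : C^o) ->
  complex.Re A = complex.Re B.
Proof.
move=> df /cvg_quarter_turn_sum /cvgrPdistC_lt f0 /cvg_quarter_turn_sum /cvgrPdistC_lt foo.
pose g z := quarter_turn_sum f z / z.
have pos (x y : R) : (0 < x ^+ 2 + y ^+ 2) -> (x +i* y)%C != 0.
  by apply: contraTneq => -[-> ->]; rewrite expr0n addr0 ltxx.
have dg z : z != 0 -> holomorphic_at g z.
  move=> z0; apply: holomorphic_atM; first exact: holomorphic_at_quarter_turn_sum.
  by apply: (@holomorphic_atV id) => //; exact: holomorphic_at_id.
have ge (x y : R) : g (- y +i* x)%C = - 'i%C * g (x +i* y)%C.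
  have -> : (- y +i* x)%C = 'i%C * (x +i* y)%C by simpc.
  rewrite /g quarter_turn_sumE invfM inv_i.
  by ring.
suff : complex.Re (A + A + A + A) = complex.Re (B + B + B + B).
  by case: A B {f0 foo} => [a1 a2] [b1 b2] /= => E; lra.
apply: (PlaneIntegrals.simple_pole_residues (fun x y => complex.Re (g (x +i* y)%C))
   (fun x y => complex.Im (g (x +i* y)%C)) _ (complex.Im (A + A + A + A))
   _ (complex.Im (B + B + B + B))).
- move=> x y /RltP xy; apply: holomorphic_at_cauchy_riemann; apply/dg/pos.
  by rewrite -!RpowE.
- by move=> x y; rewrite ge; case: (g _) => u v /=; rewrite oppr0 mul0r sub0r mulN1r opprK.
- by move=> x y; rewrite ge; case: (g _) => u v /=; rewrite oppr0 mul0r add0r mulN1r.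
- move=> eta /RltP eta0.
  have eta0C : 0 < eta%:C%C :> C by rewrite ltcR.
  have [d d0 H] := (near_punctured_disk _ _).1 (f0 _ eta0C).
  exists (d / 2); split; first by apply/RltP; rewrite divr_gt0.
  move=> x y /RltP x0 /RltP xd /RleP yx; rewrite RabsE in yx.
  rewrite RabsE !RmultE RdivE RdivE !RpowE; apply/RleP.
  apply: simple_pole_estimate => //; apply: ltW; apply: H.
    by apply: pos; rewrite ltr_wpDr ?sqr_ge0 // exprn_gt0.
  rewrite subr0; apply: le_lt_trans (norm_complex_le _ _) _; rewrite ltcR gtr0_norm //.
  by rewrite [ltRHS]splitr ltr_leD // ltW // (le_lt_trans yx).
- move=> eta /RltP eta0.
  have eta0C : 0 < eta%:C%C :> C by rewrite ltcR.
  have [d d0 H] := (near_punctured_disk _ _).1 (foo _ eta0C).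
  exists (d^-1) => x y /RltP x0 /RltP xd /RleP yx.
  rewrite RabsE !RmultE RdivE RdivE !RpowE; apply/RleP.
  apply: simple_pole_estimate => //; apply: ltW.
  have z0 : (x +i* y)%C != 0 by apply: pos; rewrite ltr_wpDr ?sqr_ge0 // exprn_gt0.
  have := H (x +i* y)%C^-1; rewrite -quarter_turn_sum_inv invrK; apply.
    by rewrite invr_eq0.
  rewrite subr0 normfV.
  have xz : x%:C%C <= `|(x +i* y)%C : C|.
    rewrite normc_def lecR /= -{1}(ger0_norm (ltW x0)) -sqrtr_sqr.
    by rewrite ler_wsqrtr // lerDl sqr_ge0.
  have x0C : 0 < x%:C%C :> C by rewrite ltcR.
  have z0' : 0 < `|(x +i* y)%C : C| by exact: lt_le_trans xz.
  apply: (@le_lt_trans _ _ (x%:C%C)^-1); first by rewrite lef_pV2 ?posrE.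
  by rewrite -fmorphV ltcR -[d]invrK ltf_pV2 ?posrE ?invr_gt0.
Qed.

(** The sum of f over the quarter turns, divided by z, is asymptotic to 4A / z at 0 and
    to 4B / z at infinity; comparing its side integrals gives Re A = Re B, and the same for
    i f gives Im A = Im B. *)
Theorem limits_at_0_and_oo (f : C -> C) (A B : C) :
  (forall z, z != 0 -> holomorphic_at f z) ->
  (f : C^o -> C^o) @ (0 : C^o)^' --> (A : C^o) ->
  (fun w : C^o => f w^-1 : C^o) @ (0 : C^o)^' --> (B : C^o) ->
  A = B.
Proof.
move=> df f0 foo.
have Re_eq := Re_limits_at_0_and_oo df f0 foo.
have Im_eq : complex.Re ('i%C * A) = complex.Re ('i%C * B).
  apply: (@Re_limits_at_0_and_oo (fun z => 'i%C * f z)).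
  - move=> z z0; apply: holomorphic_atM; [exact: holomorphic_at_cst | exact: df].
  - by apply: cvgM; [exact: cvg_cst | exact: f0].
  - by apply: cvgM; [exact: cvg_cst | exact: foo].
move: Re_eq Im_eq; case: A B {f0 foo} => [a1 a2] [b1 b2] /= ->.
by rewrite !mul0r !mul1r !sub0r => /oppr_inj ->.
Qed.

(** * Entire functions of quadratic growth *)

Lemma holomorphic_at_continuous (f : C -> C) (z : C) : holomorphic_at f z ->
  (f : C^o -> C^o) @ (z : C^o)^' --> (f z : C^o).
Proof.
move=> [/derivable1_diffP /differentiable_continuous cf].
exact: cvg_within_filter cf.
Qed.

Lemma near_neq0 : \forall w \near (0 : C^o)^', w != 0.
Proof. exact: nbhs_dnbhs_neq. Qed.

(** The hypothesis on u lets a limit at 0 that ignores the value at 0 pass through u. *)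
Lemma cvg_punctured_comp (f u : C -> C) (l : C) :
  holomorphic_at u 0 -> u 0 = 0 -> (\forall w \near (0 : C^o)^', u w != 0) ->
  (f : C^o -> C^o) @ (0 : C^o)^' --> (l : C^o) ->
  (fun w : C^o => f (u w) : C^o) @ (0 : C^o)^' --> (l : C^o).
Proof.
move=> /holomorphic_at_continuous => + u0 un0 /cvgrPdist_lt cvgf.
rewrite u0 => /cvgrPdistC_lt cu; apply/cvgrPdist_lt => e e0.
have /near_punctured_disk [d d0 H] := cvgf _ e0.
have d0C : 0 < d%:C%C :> C by rewrite ltcR.
apply: filterS2 (cu _ d0C) un0 => w; rewrite subr0 => uwd uw0.
by apply: H => //; rewrite subr0.
Qed.

Lemma zero_derivative_const (f : C -> C) :
  (forall z, complex_derivative f z 0) -> forall z w, f z = f w.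
Proof.
move=> df [x y] [x' y'].
have dRe s t := (complex_derivative_diff2 (df (s +i* t)%C)).1.
have dIm s t := (complex_derivative_diff2 (df (s +i* t)%C)).2.
rewrite /= oppr0 in dRe.
have := PlaneIntegrals.diff2_zero_const _ dRe x y x' y'.
have := PlaneIntegrals.diff2_zero_const _ dIm x y x' y'.
by case: (f _) (f _) => [a b] [c d] /= -> ->.
Qed.

(** The difference quotient h |-> (f(p + h) - f(p)) / h has limit f'(p) at 0 and limit 0
    at infinity, so f'(p) = 0 for every p.  The hypothesis says that f(z) / z tends to 0. *)
Theorem sublinear_entire_const (f : C -> C) :
  (forall z, holomorphic_at f z) ->
  (fun w : C^o => w * f w^-1 : C^o) @ (0 : C^o)^' --> (0 : C^o) ->
  forall z w, f z = f w.
Proof.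
move=> df foo; apply: zero_derivative_const => p.
have [c dc] := holomorphic_at_derivative (df p).
suff <- : c = 0 by [].
apply: (limits_at_0_and_oo _ dc).
  move=> z z0; apply: holomorphic_atM; last first.
    exact: holomorphic_atV z0 (holomorphic_at_id z).
  apply: holomorphic_atB; last exact: holomorphic_at_cst.
  apply: (@holomorphic_at_comp f (fun z => z + p)); last exact: df.
  by apply: holomorphic_atD; [exact: holomorphic_at_id | exact: holomorphic_at_cst].
have dlin (w : C) : holomorphic_at (fun w => 1 + p * w) w.
  apply: holomorphic_atD; first exact: holomorphic_at_cst.
  by apply: holomorphic_atM; [exact: holomorphic_at_cst | exact: holomorphic_at_id].
have one_p : 1 + p * 0 != 0 by rewrite mulr0 addr0 oner_eq0.
have lin_neq0 : \forall w \near (0 : C^o)^', 1 + p * w != 0.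
  have /cvgrPdist_lt := holomorphic_at_continuous (dlin 0).
  rewrite mulr0 addr0 => /(_ 1 ltr01); apply: filterS => w.
  by apply: contraTneq => ->; rewrite subr0 normr1 ltxx.
(* If w = 1 / h then u w = 1 / (h + p). *)
pose u w := w / (1 + p * w).
have du : holomorphic_at u 0.
  by apply: holomorphic_atM; [exact: holomorphic_at_id | exact: holomorphic_atV].
have u0 : u 0 = 0 by rewrite /u mul0r.
have un0 : \forall w \near (0 : C^o)^', u w != 0.
  apply: filterS2 lin_neq0 near_neq0 => w lw w0.
  by rewrite mulf_neq0 // invr_eq0.
have := cvg_punctured_comp du u0 un0 foo.
have lin1 := holomorphic_at_continuous (dlin 0).
have wp : (fun w : C^o => w * f p : C^o) @ (0 : C^o)^' --> (0 * f p : C^o).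
  apply: (@holomorphic_at_continuous (fun w => w * f p)).
  by apply: holomorphic_atM; [exact: holomorphic_at_id | exact: holomorphic_at_cst].
move=> /(cvgM lin1) /cvgB /(_ wp); rewrite mulr0 mul0r subr0.
apply: cvg_trans; apply: near_eq_cvg.
apply: filterS2 lin_neq0 near_neq0 => w lw w0 /=.
have ui : (u w)^-1 = w^-1 + p by rewrite /u; field; rewrite lw w0.
rewrite [LHS]/= -[LHS]/((1 + p * w) * (u w * f (u w)^-1) - w * f p) ui invrK /u; field.
exact: lw.
Qed.

(** The hypothesis says that f(z) / z^2 extends holomorphically to infinity, where it
    takes the value g 0.  With d = g'(0), the function f(z) - d z - (g 0) z^2 is o(z). *)
Theorem quadratic_entire (f g : C -> C) :
  (forall z, holomorphic_at f z) -> holomorphic_at g 0 ->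
  (\forall w \near (0 : C^o)^', w ^+ 2 * f w^-1 = g w) ->
  exists d, forall z, f z = f 0 + d * z + g 0 * z ^+ 2.
Proof.
move=> df dg fg; have [d dd] := holomorphic_at_derivative dg; exists d.
pose h z := f z - (d * z + g 0 * (z * z)).
have dh z : holomorphic_at h z.
  apply: holomorphic_atB (df z) _; apply: holomorphic_atD; apply: holomorphic_atM.
  - exact: holomorphic_at_cst.
  - exact: holomorphic_at_id.
  - exact: holomorphic_at_cst.
  - by apply: holomorphic_atM; exact: holomorphic_at_id.
have hoo : (fun w : C^o => w * h w^-1 : C^o) @ (0 : C^o)^' --> (0 : C^o).
  have : (fun w : C^o => (g (w + 0) - g 0) / w - d : C^o) @ (0 : C^o)^' --> (d - d : C^o).
    by apply: cvgB; [exact: dd | exact: cvg_cst].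
  rewrite subrr.
  apply: cvg_trans; apply: near_eq_cvg.
  apply: filterS2 fg near_neq0 => w fgw w0 /=.
  by rewrite addr0 -fgw /h; field.
move=> z; have := sublinear_entire_const dh hoo z 0.
rewrite /h !mulr0 addr0 subr0 => /eqP; rewrite subr_eq => /eqP ->.
by rewrite addrA expr2.
Qed.

(** * Points of projective space and Mobius maps *)

Lemma vlineZ n (c : C) (v : 'rV[C]_n) : c != 0 -> <[c *: v]>%VS = <[v]>%VS.
Proof.
move=> c0; apply/eqP; rewrite eqEsubv -!memvE memvZ ?memv_line //=.
by rewrite -{1}(scalerK c0 v) memvZ ?memv_line.
Qed.

Lemma vline_eq n (u v : 'rV[C]_n) : u != 0 -> <[u]>%VS = <[v]>%VS ->
  exists2 c : C, c != 0 & u = c *: v.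
Proof.
move=> u0 uv; have /vlineP [c uE] : u \in <[v]>%VS by rewrite -uv memv_line.
by exists c => //; apply: contraNneq u0 => c0; rewrite uE c0 scale0r.
Qed.

Lemma point_line n (p : CP n) : exists2 u, u != 0 & val p = <[u]>%VS.
Proof.
have p1 : \dim (val p) = 1%N by apply/eqP; exact: (valP p).
have v0 : vpick (val p) != 0 by rewrite vpick0 -dimv_eq0 p1.
exists (vpick (val p)) => //.
by apply/esym/eqP; rewrite eqEdim -memvE memv_pick p1 dim_vline v0.
Qed.

Lemma ord2P (i : 'I_2) : i = 0 \/ i = 1.
Proof. by case: i => [[|[|//]] ?]; [left | right]; exact: val_inj. Qed.

Lemma row2P (u v : 'rV[C]_2) : u 0 0 = v 0 0 -> u 0 1 = v 0 1 -> u = v.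
Proof. by move=> e0 e1; apply/rowP => j; case: (ord2P j) => ->. Qed.

Lemma row2_neq0 (u : 'rV[C]_2) : u != 0 -> u 0 0 = 0 -> u 0 1 != 0.
Proof. by move=> u0 e0; apply: contraNneq u0 => e1; apply/eqP/row2P; rewrite ?mxE. Qed.

Lemma chart0_line z (u : 'rV[C]_2) : u 0 0 != 0 -> u 0 1 = z * u 0 0 ->
  val (chart 0 z) = <[u]>%VS.
Proof.
move=> u0 u1; rewrite /= -(vlineZ (chart_vec 0 z) u0); congr <[_]>%VS.
by apply: row2P; rewrite !mxE /= ?mulr1 // u1 mulrC.
Qed.

Lemma chart1_line z (u : 'rV[C]_2) : u 0 1 != 0 -> u 0 0 = z * u 0 1 ->
  val (chart 1 z) = <[u]>%VS.
Proof.
move=> u1 u0; rewrite /= -(vlineZ (chart_vec 1 z) u1); congr <[_]>%VS.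
by apply: row2P; rewrite !mxE /= ?mulr1 // u0 mulrC.
Qed.

Lemma chart_inv w : w != 0 -> chart 1 w = chart 0 w^-1.
Proof.
move=> w0; apply: val_inj; rewrite (@chart0_line _ (chart_vec 1 w)) // !mxE //=.
by rewrite mulVf.
Qed.

(** The map induced on points by a homogeneous map of vectors.  The point x is only a
    default value, for lines that F sends to 0. *)
Definition descend n (F : 'rV[C]_2 -> 'rV[C]_n.+1) (x : CP n) (p : CP 1) : CP n :=
  insubd x <[F (vpick (val p))]>%VS.

(** The second clause is the absence of common zeros, which makes F induce a map on
    projective space. *)
Definition homogeneous n (d : nat) (F : 'rV[C]_2 -> 'rV[C]_n.+1) :=
  (forall c u, F (c *: u) = c ^+ d *: F u) /\ (forall u, u != 0 -> F u != 0).

Lemma descendE n d (F : 'rV[C]_2 -> 'rV[C]_n.+1) x p u : homogeneous d F ->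
  u != 0 -> val p = <[u]>%VS -> val (descend F x p) = <[F u]>%VS.
Proof.
move=> [Fhom F0] u0 pu; have p0 : vpick (val p) != 0.
  by rewrite vpick0 pu -dimv_eq0 dim_vline u0.
rewrite val_insubd dim_vline F0 //.
have /vlineP [c pE] : vpick (val p) \in <[u]>%VS by rewrite -pu memv_pick.
rewrite pE Fhom vlineZ // expf_neq0 //.
by apply: contraNneq p0 => c0; rewrite pE c0 scale0r.
Qed.

Lemma holomorphic_descend n d (F : 'rV[C]_2 -> 'rV[C]_n.+1) x : homogeneous d F ->
  (forall i j z, holomorphic_at (fun z => F (chart_vec i z) 0 j) z) ->
  holomorphic (descend F x).
Proof.
move=> Fhom dF i z0; exists (fun z => F (chart_vec i z)).
apply/near_disk; exists 1; [exact: ltr01 | move=> z _; split=> [|j]].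
  exact: (descendE _ Fhom (chart_vec_neq0 i z)).
exact: (holomorphic_at_derivable (dF i j z)).
Qed.

(** The determinant of (u, v), which vanishes exactly when u and v span the same point of
    the projective line; in each chart it becomes plus or minus a difference of coordinates. *)
Definition bracket (u v : 'rV[C]_2) := u 0 0 * v 0 1 - u 0 1 * v 0 0.

Lemma bracketZl c u v : bracket (c *: u) v = c * bracket u v.
Proof. by rewrite /bracket !mxE; ring. Qed.

Lemma bracketZr c u v : bracket u (c *: v) = c * bracket u v.
Proof. by rewrite /bracket !mxE; ring. Qed.

Lemma bracket_eq0 (u v : 'rV[C]_2) : u != 0 -> v != 0 ->
  bracket u v = 0 <-> <[u]>%VS = <[v]>%VS.
Proof.
move=> u0 v0; split=> [|/(vline_eq u0) [c _ ->]]; last first.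
  by rewrite bracketZl /bracket; ring.
rewrite /bracket => /eqP; rewrite subr_eq0 => /eqP E.
have [e|n0] := eqVneq (u 0 0) 0.
  have u1 := row2_neq0 u0 e; rewrite e mul0r in E.
  have v00 : v 0 0 = 0.
    by move/esym/eqP: E; rewrite mulf_eq0 (negbTE u1) /= => /eqP.
  have v1 := row2_neq0 v0 v00.
  have -> : u = (u 0 1 / v 0 1) *: v.
    by apply: row2P; rewrite !mxE ?e ?v00 ?mulr0 // divfK.
  by rewrite vlineZ // mulf_neq0 // invr_eq0.
have v00 : v 0 0 != 0.
  apply: contraNneq v0 => v00; rewrite v00 mulr0 in E; apply/eqP/row2P; rewrite mxE //.
  by move/eqP: E; rewrite mulf_eq0 (negbTE n0) /= => /eqP.
have -> : v = (v 0 0 / u 0 0) *: u.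
  apply: row2P; rewrite !mxE ?divfK //.
  by apply: (mulfI n0); rewrite E; field.
by rewrite vlineZ // mulf_neq0 // invr_eq0.
Qed.

Definition chart_sign (i : 'I_2) : C := if i == 0 then 1 else - 1.

Lemma chart_sign_neq0 i : chart_sign i != 0.
Proof. by rewrite /chart_sign; case: ifP; rewrite ?oppr_eq0 oner_eq0. Qed.

Lemma bracket_chart_sign i z w :
  bracket (chart_vec i z) (chart_vec i w) = chart_sign i * (w - z).
Proof. by case: (ord2P i) => ->; rewrite /bracket /chart_sign !mxE /=; ring. Qed.

Lemma holomorphic_chart_vec (i j : 'I_2) (z : C) :
  holomorphic_at (fun z => chart_vec i z 0 j) z.
Proof.
case: (eqVneq j i) => ji.
  rewrite (_ : (fun z => _) = fun=> 1); first exact: holomorphic_at_cst.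
  by apply/funext => w; rewrite mxE ji eqxx.
rewrite (_ : (fun z => _) = id); first exact: holomorphic_at_id.
by apply/funext => w; rewrite mxE (negbTE ji).
Qed.

Definition lin2 n (a b : 'rV[C]_n) (u : 'rV[C]_2) : 'rV[C]_n := u 0 0 *: a + u 0 1 *: b.

Lemma holomorphic_lin2 n (a b : 'rV[C]_n) i j z :
  holomorphic_at (fun z => lin2 a b (chart_vec i z) 0 j) z.
Proof.
rewrite (_ : (fun z => _) =
  fun z => chart_vec i z 0 0 * a 0 j + chart_vec i z 0 1 * b 0 j); last first.
  by apply/funext => w; rewrite !mxE.
exact: (holomorphic_atD
  (holomorphic_atM (holomorphic_chart_vec i 0 z) (holomorphic_at_cst (a 0 j) z))
  (holomorphic_atM (holomorphic_chart_vec i 1 z) (holomorphic_at_cst (b 0 j) z))).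
Qed.

Lemma bracket_lin2 (a b u v : 'rV[C]_2) :
  bracket (lin2 a b u) (lin2 a b v) = bracket a b * bracket u v.
Proof. by rewrite /bracket !mxE; ring. Qed.

(** Injectivity: if lin2 a b u = 0, then bracket u is identically 0, because lin2 a b
    multiplies brackets by bracket a b. *)
Lemma homogeneous_lin2 (a b : 'rV[C]_2) : bracket a b != 0 -> homogeneous 1 (lin2 a b).
Proof.
move=> ab; split=> [c u|u u0].
  by rewrite expr1 /lin2 !mxE scalerDr !scalerA.
apply/eqP => Mu.
have Bu v : bracket u v = 0.
  by apply: (mulfI ab); rewrite -bracket_lin2 Mu /bracket !mxE; ring.
move: u0; apply/negP; rewrite negbK; apply/eqP/row2P; rewrite mxE.
  by have := Bu (chart_vec 1 0); rewrite /bracket !mxE /= mulr1 mulr0 subr0.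
by have := Bu (chart_vec 0 0); rewrite /bracket !mxE /= mulr1 mulr0 sub0r => /eqP; rewrite oppr_eq0 => /eqP.
Qed.

Definition mobius (a b : 'rV[C]_2) : CP 1 -> CP 1 := descend (lin2 a b) (chart 0 0).

(** The columns (adjl, adjr) of the adjugate of the matrix with columns a and b, whose
    Mobius map is the inverse of mobius a b. *)
Definition adjl (a b : 'rV[C]_2) : 'rV[C]_2 := \row_j (if j == 0 then b 0 1 else - a 0 1).
Definition adjr (a b : 'rV[C]_2) : 'rV[C]_2 := \row_j (if j == 0 then - b 0 0 else a 0 0).

Lemma bracket_adj a b : bracket (adjl a b) (adjr a b) = bracket a b.
Proof. by rewrite /bracket !mxE /=; ring. Qed.

Lemma lin2_adj a b u : lin2 a b (lin2 (adjl a b) (adjr a b) u) = bracket a b *: u.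
Proof. by apply: row2P; rewrite /bracket !mxE /=; ring. Qed.

Lemma adj_lin2 a b u : lin2 (adjl a b) (adjr a b) (lin2 a b u) = bracket a b *: u.
Proof. by apply: row2P; rewrite /bracket !mxE /=; ring. Qed.

Lemma lin2_comp (a b c d : 'rV[C]_2) u :
  lin2 a b (lin2 c d u) = lin2 (lin2 a b c) (lin2 a b d) u.
Proof. by apply: row2P; rewrite !mxE; ring. Qed.

Lemma mobiusE a b p u : bracket a b != 0 -> u != 0 -> val p = <[u]>%VS ->
  val (mobius a b p) = <[lin2 a b u]>%VS.
Proof. by move=> ab; exact: descendE (homogeneous_lin2 ab). Qed.

Lemma holomorphic_mobius a b : bracket a b != 0 -> holomorphic (mobius a b).
Proof.
move=> ab; apply: (holomorphic_descend _ (homogeneous_lin2 ab)).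
exact: holomorphic_lin2.
Qed.

Lemma mobius_comp a b c d p : bracket a b != 0 -> bracket c d != 0 ->
  mobius a b (mobius c d p) = mobius (lin2 a b c) (lin2 a b d) p.
Proof.
move=> ab cd; apply: val_inj; have [u u0 pu] := point_line p.
rewrite (mobiusE _ u0 pu) ?bracket_lin2 ?mulf_neq0 // -lin2_comp.
by apply: mobiusE (mobiusE cd u0 pu) => //; exact: (homogeneous_lin2 cd).2.
Qed.

Lemma mobius_adjK a b : bracket a b != 0 ->
  cancel (mobius (adjl a b) (adjr a b)) (mobius a b).
Proof.
move=> ab p; apply: val_inj; have [u u0 pu] := point_line p.
rewrite mobius_comp ?bracket_adj // (mobiusE _ u0 pu); last first.
  by rewrite bracket_lin2 bracket_adj mulf_neq0.
by rewrite -lin2_comp lin2_adj vlineZ.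
Qed.

Lemma mobiusK a b : bracket a b != 0 ->
  cancel (mobius a b) (mobius (adjl a b) (adjr a b)).
Proof.
move=> ab p; apply: val_inj; have [u u0 pu] := point_line p.
rewrite mobius_comp ?bracket_adj // (mobiusE _ u0 pu); last first.
  by rewrite bracket_lin2 bracket_adj mulf_neq0.
by rewrite -lin2_comp adj_lin2 vlineZ.
Qed.

Lemma reparametrization_mobius a b : bracket a b != 0 -> reparametrization (mobius a b).
Proof.
move=> ab; split; first exact: holomorphic_mobius.
exists (mobius (adjl a b) (adjr a b)); split.
  by apply: holomorphic_mobius; rewrite bracket_adj.
by split; [exact: mobiusK | exact: mobius_adjK].
Qed.

(** * Conics *)

Lemma hyperplane_proper n (K : {vspace 'rV[C]_n.+1}) : hyperplane K -> exists e, e \notin K.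
Proof.
move=> dK; have /subvPn [e _ eK] : ~~ (fullv <= K)%VS; last by exists e.
by apply/negP => /dimvS; rewrite dK dimvf /dim /= mul1n ltnn.
Qed.

(** The form is the coordinate along a vector e outside K, in the decomposition of the
    space as the direct sum of the line of e and of K. *)
Lemma hyperplane_form n (K : {vspace 'rV[C]_n.+1}) : hyperplane K ->
  exists l : 'Hom('rV[C]_n.+1, C^o), lker l = K.
Proof.
move=> dK; have [e eK] := hyperplane_proper dK.
have [capEK addEK] := hyperplane_split dK eK.
have e0 : e != 0 by apply: contraNneq eK => ->; apply: mem0v.
pose c (x : 'rV[C]_n.+1) : C^o := coord [tuple e] ord0 (daddv_pi <[e]> K x).
have c_lin : linear c by move=> k x y; rewrite /c !linearP.
pose cL : {linear 'rV[C]_n.+1 -> C^o} :=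
  HB.pack c (GRing.isLinear.Build _ _ _ _ _ c_lin).
have xK x : x \in (<[e]> + K)%VS by rewrite addEK memvf.
have piE x : daddv_pi <[e]> K x = c x *: e.
  have /coord_span : daddv_pi <[e]> K x \in <<[tuple e]>>%VS.
    by rewrite span_seq1; exact: memv_pi.
  by rewrite big_ord1.
exists (linfun cL); apply/vspaceP => x; rewrite memv_ker lfunE /=.
have capKE : (K :&: <[e]> = 0)%VS by rewrite capvC.
have decomp : c x *: e + daddv_pi K <[e]> x = x by rewrite -piE; exact: daddv_pi_add.
apply/eqP/idP => [cx|xinK].
  by rewrite -decomp cx scale0r add0r; exact: memv_pi.
move: decomp; rewrite (daddv_pi_id capKE xinK) => /eqP.
by rewrite -subr_eq0 addrK scaler_eq0 (negbTE e0) orbF => /eqP.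
Qed.

Definition conic n (a e b : 'rV[C]_n) (u : 'rV[C]_2) : 'rV[C]_n :=
  u 0 0 ^+ 2 *: a + (u 0 0 * u 0 1) *: e + u 0 1 ^+ 2 *: b.

Lemma conicE n (a e b : 'rV[C]_n) u j : conic a e b u 0 j =
  u 0 0 * u 0 0 * a 0 j + u 0 0 * u 0 1 * e 0 j + u 0 1 * u 0 1 * b 0 j.
Proof. by rewrite !mxE -!expr2. Qed.

Lemma conic_rescale n (a e b : 'rV[C]_n) (s t : C) (u : 'rV[C]_2) :
  conic (s ^+ 2 *: a) ((s * t) *: e) (t ^+ 2 *: b) u =
  conic a e b (lin2 (s *: chart_vec 0 0) (t *: chart_vec 1 0) u).
Proof.
have e0 : lin2 (s *: chart_vec 0 0) (t *: chart_vec 1 0) u 0 0 = u 0 0 * s.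
  by rewrite !mxE /= !mulr1 !mulr0 addr0.
have e1 : lin2 (s *: chart_vec 0 0) (t *: chart_vec 1 0) u 0 1 = u 0 1 * t.
  by rewrite !mxE /= !mulr1 !mulr0 add0r.
by rewrite /conic e0 e1 !exprMn [_ * s * (_ * t)]mulrACA !scalerA.
Qed.

Lemma holomorphic_conic n (a e b : 'rV[C]_n) (i : 'I_2) (j : 'I_n) (z : C) :
  holomorphic_at (fun z => conic a e b (chart_vec i z) 0 j) z.
Proof.
rewrite (_ : (fun z => _) = fun z => chart_vec i z 0 0 * chart_vec i z 0 0 * a 0 j
  + chart_vec i z 0 0 * chart_vec i z 0 1 * e 0 j
  + chart_vec i z 0 1 * chart_vec i z 0 1 * b 0 j); last first.
  by apply/funext => w; exact: conicE.
have d0 := holomorphic_chart_vec i 0 z; have d1 := holomorphic_chart_vec i 1 z.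
have dc c := holomorphic_at_cst c z.
exact: (holomorphic_atD (holomorphic_atD
  (holomorphic_atM (holomorphic_atM d0 d0) (dc _))
  (holomorphic_atM (holomorphic_atM d0 d1) (dc _)))
  (holomorphic_atM (holomorphic_atM d1 d1) (dc _))).
Qed.

(** Modulo H the value is u0 u1 e, so it is nonzero when u0 and u1 are; when one of them
    vanishes it is a nonzero multiple of a or of b. *)
Lemma homogeneous_conic n (H : {vspace 'rV[C]_n.+1}) (a e b : 'rV[C]_n.+1) :
  a \in H -> b \in H -> e \notin H -> a != 0 -> b != 0 -> homogeneous 2 (conic a e b).
Proof.
move=> aH bH eH a0 b0; split=> [c u|u u0].
  by rewrite /conic !mxE !exprMn [c * _ * (c * u 0 1)]mulrACA -[c * c]expr2 !scalerDr !scalerA.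
apply/eqP => cu; have : u 0 0 * u 0 1 = 0.
  apply/eqP; apply: contraNT eH => u01; rewrite -(scalerK u01 e) memvZ //.
  have -> : (u 0 0 * u 0 1) *: e =
      conic a e b u - (u 0 0 ^+ 2 *: a + u 0 1 ^+ 2 *: b).
    by rewrite /conic [X in X - _]addrAC [X in X - _]addrC addrK.
  by rewrite cu rpredB ?rpred0 // rpredD // memvZ.
move/eqP; rewrite mulf_eq0 => /orP[] /eqP e0.
  move/eqP: cu; rewrite /conic e0 mul0r expr0n !scale0r !add0r scaler_eq0 (negbTE b0) orbF.
  by rewrite expf_eq0 /= (negbTE (row2_neq0 u0 e0)).
move/eqP: cu; rewrite /conic e0 mulr0 expr0n !scale0r !addr0 scaler_eq0 (negbTE a0) orbF.
rewrite expf_eq0 /= => /eqP e1; move/eqP: u0; apply; apply: row2P; by rewrite ?e0 ?e1 mxE.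
Qed.

(** The roots are given by chart vectors, so that they come with the chart in which
    multiplicities are computed; the root at infinity, present when c = 0, is
    chart_vec 1 0. *)
Lemma binary_quadratic_split (a b c : C) : ~ [/\ a = 0, b = 0 & c = 0] ->
  exists k i z j w, k != 0 /\ forall u : 'rV[C]_2,
    a * u 0 0 ^+ 2 + b * (u 0 0 * u 0 1) + c * u 0 1 ^+ 2 =
    k * bracket (chart_vec i z) u * bracket (chart_vec j w) u.
Proof.
move=> nz; have [c0|c0] := eqVneq c 0; last first.
  pose d := sqrtC (b ^+ 2 - 4 * a * c).
  have dE : d ^+ 2 = b ^+ 2 - 4 * a * c := sqrtCK _.
  have aE : a = (b ^+ 2 - d ^+ 2) / (4 * c) by rewrite dE; field.
  exists c, 0, ((- b + d) / (2 * c)), 0, ((- b - d) / (2 * c)); split=> // u.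
  by rewrite /bracket !mxE /= aE; field.
have [b0|b0] := eqVneq b 0; last first.
  exists (- b), 1, 0, 0, (- a / b); split; first by rewrite oppr_eq0.
  by move=> u; rewrite /bracket !mxE /= c0; field.
have [a0|a0] := eqVneq a 0; first by case: nz.
by exists a, 1, 0, 1, 0; split=> // u; rewrite /bracket !mxE /= b0 c0; ring.
Qed.

(** Pulled back along the conic, a linear form is a nonzero binary quadratic form, hence
    a product of two brackets: its zeros are one point with multiplicity 2 or two points
    with multiplicity 1. *)
Lemma has_degree_conic n (a e b : 'rV[C]_n.+1) x : homogeneous 2 (conic a e b) ->
  has_degree (descend (conic a e b) x) 2.
Proof.
set f := descend _ _ => conic_hom K dK notK.
have [l kerl] := hyperplane_form dK.
have lE u : l (conic a e b u) = l a * u 0 0 ^+ 2 + l e * (u 0 0 * u 0 1) + l b * u 0 1 ^+ 2.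
  by rewrite /conic !linearD !linearZ /=; congr (_ + _ + _); exact: mulrC.
have inK p u : u != 0 -> val p = <[u]>%VS -> pts K (f p) <-> l (conic a e b u) = 0.
  move=> u0 pu; rewrite /pts /= (descendE _ conic_hom u0 pu) -memvE -kerl memv_ker.
  by split=> /eqP.
have [k [i [z [j [w [k0 split_q]]]]]] : exists k i z j w, k != 0 /\ forall u,
    l (conic a e b u) = k * bracket (chart_vec i z) u * bracket (chart_vec j w) u.
  have [|k [i [z [j [w [k0 E]]]]]] := @binary_quadratic_split (l a) (l e) (l b).
    move=> [a0 e0 b0]; apply: notK => _ [p _ <-].
    have [u u0 pu] := point_line p.
    by apply/(inK _ _ u0 pu); rewrite lE a0 e0 b0 !mul0r !addr0.
  by exists k, i, z, j, w; split=> // u; rewrite lE E.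
(* The lift of f near any point is the conic itself, so a multiplicity is read off from a
   factorization that holds on the whole chart. *)
have mult i' z' m g : (forall t, holomorphic_at g t) -> g z' != 0 ->
    (forall t, l (conic a e b (chart_vec i' t)) = (t - z') ^+ m * g t) ->
    inter_mult f K (chart i' z') m.
  move=> dg gz E; exists i', z', (fun t => conic a e b (chart_vec i' t)), l, g.
  split=> //; split; last split=> //; last split=> //.
    apply/near_disk; exists 1; [exact: ltr01 | move=> t _; split=> [|j']].
      exact: (descendE _ conic_hom (chart_vec_neq0 _ _)).
    exact: (holomorphic_at_derivable (holomorphic_conic _ _ _ _ _ _)).
  apply/near_disk; exists 1; [exact: ltr01 | move=> t _; split=> //].
  exact: (holomorphic_at_derivable (dg t)).
have zeros p : pts K (f p) <-> p = chart i z \/ p = chart j w.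
  have [u u0 pu] := point_line p; rewrite (inK p u u0 pu) split_q.
  have eq_chart i' z' : p = chart i' z' <-> bracket (chart_vec i' z') u = 0.
    rewrite (bracket_eq0 (chart_vec_neq0 _ _) u0) -pu.
    by split=> [->|E] //; exact: val_inj.
  rewrite !eq_chart; split=> [/eqP|].
    by rewrite !mulf_eq0 (negbTE k0) /= => /orP[] /eqP; [left | right].
  by case=> ->; rewrite ?mulr0 ?mul0r.
have dbr i' z' j' t : holomorphic_at (fun t => bracket (chart_vec i' z') (chart_vec j' t)) t.
  by apply: holomorphic_atB; apply: holomorphic_atM (holomorphic_at_cst _ _) _;
     exact: holomorphic_chart_vec.
have [pp|pp] := eqVneq (chart i z) (chart j w).
  have [c c0 wE] := vline_eq (chart_vec_neq0 j w) (esym (congr1 val pp)).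
  exists [:: chart i z], (fun=> 2%N); split=> //; split.
    move=> p; rewrite zeros -pp inE; split=> [/eqP|[]] ->; by [left | rewrite eqxx].
  split; last by rewrite big_seq1.
  move=> p; rewrite inE => /eqP ->.
  apply: (mult _ _ _ (fun=> k * c)) => [t||t]; first exact: holomorphic_at_cst.
    exact: mulf_neq0.
  rewrite split_q wE bracketZl bracket_chart_sign /chart_sign; case: ifP => _; ring.
have neq_br : bracket (chart_vec i z) (chart_vec j w) != 0.
  apply: contraNneq pp => /(bracket_eq0 (chart_vec_neq0 _ _) (chart_vec_neq0 _ _)) E.
  by apply/eqP/val_inj.
have neq_br' : bracket (chart_vec j w) (chart_vec i z) != 0.
  apply: contraNneq pp => /(bracket_eq0 (chart_vec_neq0 _ _) (chart_vec_neq0 _ _)) E.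
  by apply/eqP/val_inj.
exists [:: chart i z; chart j w], (fun=> 1%N); split; first by rewrite /= inE pp.
split.
  move=> p; rewrite zeros !inE; split=> [/orP[] /eqP ->|[] ->]; rewrite ?eqxx ?orbT //;
  by [left | right].
split; last by rewrite big_cons big_seq1.
move=> p; rewrite !inE => /orP[] /eqP ->.
  apply: (mult _ _ _ (fun t => (k * chart_sign i) * bracket (chart_vec j w) (chart_vec i t))).
  - by move=> t; apply: holomorphic_atM (holomorphic_at_cst _ _) (dbr _ _ _ _).
  - by rewrite !mulf_neq0 // chart_sign_neq0.
  - by move=> t; rewrite split_q bracket_chart_sign expr1; ring.
apply: (mult _ _ _ (fun t => (k * chart_sign j) * bracket (chart_vec i z) (chart_vec j t))).
- by move=> t; apply: holomorphic_atM (holomorphic_at_cst _ _) (dbr _ _ _ _).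
- by rewrite !mulf_neq0 // chart_sign_neq0.
- by move=> t; rewrite split_q bracket_chart_sign expr1; ring.
Qed.

(** * Lifts in the charts of the projective line *)

Lemma near_holomorphic_comp (u : C -> C) (z : C) (P : C -> Prop) : holomorphic_at u z ->
  (\forall w \near (u z : C^o), P w) -> \forall w \near (z : C^o), P (u w).
Proof.
by move=> [/derivable1_diffP /differentiable_continuous cu] /cu.
Qed.

Lemma near_holomorphic_neq0 (u : C -> C) (z : C) : holomorphic_at u z -> u z != 0 ->
  \forall w \near (z : C^o), u w != 0.
Proof.
move=> du uz; apply: (near_holomorphic_comp (P := fun w => w != 0) du).
have /complex_realP [r rE] : `|u z| \is Num.real := normr_real _.
apply/near_disk; exists r => [|w]; first by rewrite -ltcR -rE normr_gt0.
by rewrite -rE; apply: contraTneq => ->; rewrite sub0r normrN ltxx.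
Qed.

Definition other (i : 'I_2) : 'I_2 := if i == 0 then 1 else 0.

Lemma chart_vec_line i (u : 'rV[C]_2) : u 0 i != 0 ->
  u = u 0 i *: chart_vec i (u 0 (other i) / u 0 i).
Proof.
case: (ord2P i) => -> /= ui; apply: row2P; rewrite !mxE /other /= ?mulr1 //.
  by rewrite mulrCA mulfV // mulr1.
by rewrite mulrCA mulfV // mulr1.
Qed.

(** A Mobius map read in the charts j and i is a holomorphic function m with nonzero
    derivative.  The factor k, which makes this precise without differentiating, comes from
    the fact that lin2 a b multiplies brackets by bracket a b. *)
Lemma mobius_in_charts (a b : 'rV[C]_2) i j (z0 w0 : C) : bracket a b != 0 ->
  mobius a b (chart j z0) = chart i w0 ->
  exists m k : C -> C, [/\ m z0 = w0, k z0 != 0 & \forall z \near (z0 : C^o),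
    [/\ mobius a b (chart j z) = chart i (m z), holomorphic_at m z, holomorphic_at k z
      & m z - w0 = (z - z0) * k z]].
Proof.
move=> ab Mz0; pose y z := lin2 a b (chart_vec j z).
have valM z : val (mobius a b (chart j z)) = <[y z]>%VS.
  exact: mobiusE (chart_vec_neq0 j z) _.
have yn0 z : y z != 0 := (homogeneous_lin2 ab).2 _ (chart_vec_neq0 j z).
have dy i' z : holomorphic_at (fun z => y z 0 i') z := holomorphic_lin2 a b j i' z.
have [c c0 yz0] : exists2 c, c != 0 & y z0 = c *: chart_vec i w0.
  by apply: vline_eq => //; rewrite -valM Mz0.
have yi0 : y z0 0 i = c by rewrite yz0 !mxE eqxx mulr1.
pose m z := y z 0 (other i) / y z 0 i.
pose k z := bracket a b * chart_sign j / (chart_sign i * c) / y z 0 i.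
have chartM z : y z 0 i != 0 -> mobius a b (chart j z) = chart i (m z).
  by move=> yi; apply: val_inj; rewrite valM (chart_vec_line yi) vlineZ.
have mk z : y z 0 i != 0 -> m z - w0 = (z - z0) * k z.
  move=> yi; have := bracket_lin2 a b (chart_vec j z0) (chart_vec j z).
  rewrite -/(y z0) -/(y z) (chart_vec_line yi) -/(m z) yz0 bracketZl bracketZr.
  rewrite !bracket_chart_sign => E; rewrite /k.
  apply: (mulfI (mulf_neq0 (mulf_neq0 c0 yi) (chart_sign_neq0 i))).
  rewrite -!mulrA E; field.
  by rewrite c0 yi chart_sign_neq0.
exists m, k; split.
- by apply/eqP; rewrite -subr_eq0 mk ?yi0 // subrr mul0r.
- by rewrite /k yi0 !mulf_neq0 ?invr_eq0 ?mulf_neq0 ?chart_sign_neq0.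
have yi_near : \forall z \near (z0 : C^o), y z 0 i != 0.
  by apply: (near_holomorphic_neq0 (dy i z0)); rewrite yi0.
apply: filterS yi_near => z yi; split.
- exact: chartM.
- by apply: holomorphic_atM (dy _ z) _; apply: holomorphic_atV (dy i z).
- by apply: holomorphic_atM (holomorphic_at_cst _ z) _; apply: holomorphic_atV (dy i z).
- exact: mk.
Qed.

Lemma lift_near_mobius n (f : CP 1 -> CP n) a b i j (z0 : C) (m : C -> C) F :
  (\forall z \near (z0 : C^o), mobius a b (chart j z) = chart i (m z) /\ holomorphic_at m z) ->
  lift_near (f \o chart i) (m z0) F ->
  lift_near (f \o mobius a b \o chart j) z0 (F \o m).
Proof.
move=> Mm; have [_ dm0] := nbhs_singleton Mm.
move=> /(near_holomorphic_comp dm0); apply: filterS2 Mm => z [Mz dm] /= [valF dF].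
split=> [|j']; first by rewrite Mz.
apply: holomorphic_at_derivable.
exact: (@holomorphic_at_comp (fun w => F w 0 j') m z dm (HolomorphicAt (dF j'))).
Qed.

Lemma holomorphic_comp_mobius n (f : CP 1 -> CP n) a b :
  bracket a b != 0 -> holomorphic f -> holomorphic (f \o mobius a b).
Proof.
move=> ab hf j z0.
have [i [w0 Mz0]] : exists i w0, mobius a b (chart j z0) = chart i w0.
  have [u u0 pu] := point_line (mobius a b (chart j z0)).
  have [e|n0] := eqVneq (u 0 0) 0.
    exists 1, (u 0 0 / u 0 1); apply: val_inj; rewrite pu.
    by rewrite (@chart1_line _ u) ?divfK // row2_neq0.
  by exists 0, (u 0 1 / u 0 0); apply: val_inj; rewrite pu (@chart0_line _ u) ?divfK.
have [m [k [mz0 _ Mm]]] := mobius_in_charts ab Mz0.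
have [F lF] := hf i w0; exists (F \o m); rewrite -mz0 in lF.
by apply: lift_near_mobius lF; apply: filterS Mm => z [].
Qed.

Lemma proportional_forms n (l l' : 'Hom('rV[C]_n.+1, C^o)) e :
  lker l = lker l' -> e \notin lker l -> exists2 c : C, c != 0 & forall x, l x = c * l' x.
Proof.
move=> ker_eq eK; pose p x : C := l x; pose p' x : C := l' x.
have pE x : (x \in lker l) = (p x == 0) by rewrite memv_ker.
have p'E x : (x \in lker l) = (p' x == 0) by rewrite ker_eq memv_ker.
have pe : p e != 0 by rewrite -pE.
have p'e : p' e != 0 by rewrite -p'E.
exists (p e / p' e) => [|x]; first exact: mulf_neq0 pe (invr_neq0 p'e).
have : x - (p' x / p' e) *: e \in lker l.
  rewrite p'E; have -> : p' (x - (p' x / p' e) *: e) = p' x - p' x / p' e * p' e.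
    by rewrite /p' linearB linearZ.
  by rewrite (divfK p'e) subrr.
rewrite pE; have -> : p (x - (p' x / p' e) *: e) = p x - p' x / p' e * p e.
  by rewrite /p linearB linearZ.
rewrite subr_eq0 => /eqP E; change (p x = p e / p' e * p' x).
by rewrite E [LHS]mulrC mulrA [RHS]mulrAC.
Qed.

(** Multiplicities are invariant under Mobius maps: if l (F w) = (w - w0)^d g(w), then
    substituting m(z) - w0 = (z - z0) k(z) gives the factorization at z0.  Moreover the linear
    form and the chart, which inter_mult leaves unspecified, can be prescribed. *)
Lemma inter_mult_mobius n (f : CP 1 -> CP n) (l : 'Hom('rV[C]_n.+1, C^o)) e a b j z0 d :
  bracket a b != 0 -> e \notin lker l ->
  inter_mult f (lker l) (mobius a b (chart j z0)) d ->
  exists (F : C -> 'rV[C]_n.+1) (g : C -> C),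
    [/\ lift_near (f \o mobius a b \o chart j) z0 F, g z0 != 0
      & \forall z \near (z0 : C^o), holomorphic_at g z /\ l (F z) = (z - z0) ^+ d * g z].
Proof.
move=> ab eK [i [w0 [F [l' [g [Mz0 [lF [ker_l' [gw0 dg]]]]]]]]].
have [c c0 lE] := proportional_forms (esym ker_l') eK.
have [m [k [mz0 kz0 Mm]]] := mobius_in_charts ab (esym Mz0).
have [_ dm0 _ _] := nbhs_singleton Mm.
rewrite -mz0 in lF gw0 dg.
exists (F \o m), (fun z => c * k z ^+ d * g (m z)); split.
- apply: (lift_near_mobius _ lF).
  by apply: filterS Mm => z [Mz dm _ _]; split.
- exact: mulf_neq0 (mulf_neq0 c0 (expf_neq0 _ kz0)) gw0.
have := near_holomorphic_comp dm0 dg; apply: filterS2 Mm => z [_ dm dk mk] /= [dgz lFz].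
split; last by rewrite lE lFz mz0 mk exprMn; ring.
apply: holomorphic_atM; last exact: (@holomorphic_at_comp g m z dm (HolomorphicAt dgz)).
apply: holomorphic_atM (holomorphic_at_cst _ _) _.
exact: holomorphic_atX.
Qed.

(** * A curve with simple zeros at 0 and infinity is a conic *)

Lemma holomorphic_at_sum (I : Type) (r : seq I) (f : I -> C -> C) z :
  (forall i, holomorphic_at (f i) z) -> holomorphic_at (fun w => \sum_(i <- r) f i w) z.
Proof.
move=> df; elim: r => [|i r IHr].
  rewrite (_ : (fun w => _) = fun=> 0); first exact: holomorphic_at_cst.
  by apply/funext => w; rewrite big_nil.
rewrite (_ : (fun w => _) = fun w => f i w + \sum_(j <- r) f j w).
  exact: holomorphic_atD.
by apply/funext => w; rewrite big_cons.
Qed.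

Lemma holomorphic_at_form n (l : 'Hom('rV[C]_n.+1, C^o)) (F : C -> 'rV[C]_n.+1) z :
  (forall j, holomorphic_at (fun w => F w 0 j) z) -> holomorphic_at (fun w => l (F w)) z.
Proof.
move=> dF; rewrite (_ : (fun w => _) = fun w => \sum_j F w 0 j * l (delta_mx 0 j)).
  apply: holomorphic_at_sum => j.
  by apply: holomorphic_atM (holomorphic_at_cst _ z).
apply/funext => w; rewrite {1}[F w]row_sum_delta linear_sum.
by apply: eq_bigr => j _; rewrite linearZ.
Qed.

(** The representative of p on which l takes the value 1, for p outside the kernel of l. *)
Definition normalize n (l : 'Hom('rV[C]_n.+1, C^o)) (p : CP n) : 'rV[C]_n.+1 :=
  (l (vpick (val p)))^-1 *: vpick (val p).

Lemma normalizeE n l (p : CP n) v : val p = <[v]>%VS -> normalize l p = (l v)^-1 *: v.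
Proof.
move=> pv; have [u u0 pu] := point_line p.
have p0 : vpick (val p) != 0 by rewrite vpick0 pu -dimv_eq0 dim_vline u0.
have /vlineP [c pE] : vpick (val p) \in <[v]>%VS by rewrite -pv memv_pick.
have c0 : c != 0 by apply: contraNneq p0 => c0; rewrite pE c0 scale0r.
rewrite /normalize pE; have -> : l (c *: v) = c * l v by rewrite linearZ.
by rewrite scalerA invfM mulrAC mulVf // mul1r.
Qed.

(** The function Phi of the proof is z N(z), where N(z) is the representative of the
    point f(z) with l(N(z)) = 1.  Near 0 a lift F0 of f satisfies l(F0 z) = z g0(z), so
    Phi = F0 / g0 there; near infinity, in the coordinate w = 1 / z, one has
    l(F1 w) = w g1(w), so w^2 Phi(1/w) = F1(w) / g1(w).  Hence each coordinate of Phi is an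
    entire function with quadratic growth. *)
Lemma conic_of_lifts n (f : CP 1 -> CP n) (l : 'Hom('rV[C]_n.+1, C^o)) F0 g0 F1 g1 :
  holomorphic f ->
  (forall z, z != 0 -> ~ pts (lker l) (f (chart 0 z))) ->
  lift_near (f \o chart 0) 0 F0 -> g0 0 != 0 ->
  (\forall z \near (0 : C^o), holomorphic_at g0 z /\ l (F0 z) = (z - 0) ^+ 1 * g0 z) ->
  lift_near (f \o chart 1) 0 F1 -> g1 0 != 0 ->
  (\forall z \near (0 : C^o), holomorphic_at g1 z /\ l (F1 z) = (z - 0) ^+ 1 * g1 z) ->
  exists v0 v v1, [/\ val (f (chart 0 0)) = <[v0]>%VS, val (f (chart 1 0)) = <[v1]>%VS,
    l v = 1 & forall p u, u != 0 -> val p = <[u]>%VS ->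
      val (f p) = <[conic v0 v v1 u]>%VS].
Proof.
move=> hf fH lF0 g00 lg0 lF1 g10 lg1.
have [/= f00 dF0] := nbhs_singleton lF0; have [dg0 lF00] := nbhs_singleton lg0.
have [/= f10 dF1] := nbhs_singleton lF1; have [dg1 lF10] := nbhs_singleton lg1.
pose v0 := (g0 0)^-1 *: F0 0; pose v1 := (g1 0)^-1 *: F1 0.
pose Phi z := if z == 0 then v0 else z *: normalize l (f (chart 0 z)).
pose Psi w := (g1 w)^-1 *: F1 w.
have Phi_near0 : \forall z \near (0 : C^o), Phi z = (g0 z)^-1 *: F0 z.
  apply: filterS2 lF0 lg0 => z /= [fz _] [_ lFz]; rewrite /Phi.
  case: eqVneq => [-> //|z0]; rewrite (normalizeE _ fz) lFz subr0 expr1.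
  by rewrite scalerA invfM mulrA mulfV // mul1r.
have dPhi j z : holomorphic_at (fun z => Phi z 0 j) z.
  have [->|z0] := eqVneq z 0.
    apply: (@holomorphic_at_near (fun z => (g0 z)^-1 * F0 z 0 j)).
      by apply: filterS Phi_near0 => w ->; rewrite mxE.
    exact: holomorphic_atM (holomorphic_atV g00 dg0) (HolomorphicAt (dF0 j)).
  have [F lF] := hf 0 z; have [/= fz dF] := nbhs_singleton lF.
  have dF' j' := HolomorphicAt (dF j').
  have lFz : l (F z) != 0.
    by apply/eqP => lFz; apply: (fH z z0); rewrite /pts /= fz -memvE memv_ker lFz.
  apply: (@holomorphic_at_near (fun w => w * ((l (F w))^-1 * F w 0 j))).
    have nz := near_holomorphic_neq0 (holomorphic_at_id z) z0.
    apply: filterS2 lF nz => w /= [fw _] w0.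
    by rewrite /Phi (negbTE w0) (normalizeE _ fw) !mxE.
  apply: holomorphic_atM (holomorphic_at_id z) _.
  apply: holomorphic_atM (dF' j); apply: holomorphic_atV => //.
  exact: holomorphic_at_form.
have PsiE : \forall w \near (0 : C^o)^', w ^+ 2 *: Phi w^-1 = Psi w.
  rewrite near_withinE; apply: filterS2 lF1 lg1 => w /= [fw _] [_ lFw] w0.
  rewrite /Phi invr_eq0 (negbTE w0) -chart_inv // (normalizeE _ fw) lFw subr0 expr1.
  by rewrite !scalerA invfM expr2 mulfK // mulrA mulfV // mul1r.
have dPsi j : holomorphic_at (fun w => Psi w 0 j) 0.
  rewrite (_ : (fun w => _) = fun w => (g1 w)^-1 * F1 w 0 j).
    exact: holomorphic_atM (holomorphic_atV g10 dg1) (HolomorphicAt (dF1 j)).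
  by apply/funext => w; rewrite mxE.
have quad j : exists d, forall z, Phi z 0 j = v0 0 j + d * z + v1 0 j * z ^+ 2.
  have [|d dE] := quadratic_entire (dPhi j) (dPsi j).
    by apply: filterS PsiE => w /(congr1 (fun M : 'rV[C]_n.+1 => M 0 j)); rewrite mxE.
  by exists d => z; rewrite dE /Phi eqxx.
have [d dE] := choice quad.
pose v : 'rV[C]_n.+1 := \row_j d j.
have PhiE z : Phi z = v0 + z *: v + z ^+ 2 *: v1.
  by apply/rowP => j; rewrite dE !mxE; ring.
(* F0 0 and F1 0 lie in the kernel of l because l o F0 and l o F1 vanish at 0. *)
have lv0 : l v0 = 0.
  by rewrite linearZ /= lF00 subrr expr1 mul0r scaler0.
have lv1 : l v1 = 0.
  by rewrite linearZ /= lF10 subrr expr1 mul0r scaler0.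
exists v0, v, v1; split.
- by rewrite f00 vlineZ // invr_eq0.
- by rewrite f10 vlineZ // invr_eq0.
(* Evaluate l (Phi z) = z at z = 1. *)
- have o0 : (1 : C) != 0 := oner_neq0 _.
  have [u u0 pu] := point_line (f (chart 0 1)).
  have lu : l u != 0.
    by apply/eqP => lu; apply: (fH 1 o0); rewrite /pts /= pu -memvE memv_ker lu.
  have := congr1 l (PhiE 1); rewrite /Phi (negbTE o0) (normalizeE _ pu) expr1n !scale1r.
  by rewrite !linearD /= lv0 lv1 add0r addr0 => <-; rewrite linearZ /= [_ *: _]mulVf.
move=> p u u0 pu; have [e|u00] := eqVneq (u 0 0) 0.
  have u1 := row2_neq0 u0 e.
  have -> : p = chart 1 0.
    by apply: val_inj; rewrite (@chart1_line _ u) // e mul0r.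
  by rewrite f10 /conic e mul0r expr0n /= !scale0r !add0r !vlineZ // ?expf_neq0 // invr_eq0.
have -> : conic v0 v v1 u = u 0 0 ^+ 2 *: Phi (u 0 1 / u 0 0).
  have u1E : u 0 1 = u 0 0 * (u 0 1 / u 0 0) by rewrite mulrCA mulfV // mulr1.
  by rewrite PhiE /conic {1 2}u1E mulrA -expr2 exprMn !scalerDr !scalerA.
rewrite vlineZ ?expf_neq0 //.
have -> : p = chart 0 (u 0 1 / u 0 0).
  by apply: val_inj; rewrite (@chart0_line _ u) // divfK.
rewrite /Phi; case: eqVneq => [->|z0]; first by rewrite f00 vlineZ // invr_eq0.
have [x x0 fx] := point_line (f (chart 0 (u 0 1 / u 0 0))).
have lx : l x != 0.
  by apply/eqP => lx; apply: (fH _ z0); rewrite /pts /= fx -memvE memv_ker lx.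
by rewrite (normalizeE _ fx) !vlineZ // invr_eq0.
Qed.

(** * Uniqueness of the conic *)

(** If the multiplicity were 0, l would not vanish on the lift at p. *)
Lemma inter_mult_gt0 n (f : CP 1 -> CP n) (H : {vspace 'rV[C]_n.+1}) p m :
  inter_mult f H p m -> pts H (f p) -> (0 < m)%N.
Proof.
case: m => // -[i [z0 [F [l [g [pE [lF [kerl [gz0 lg]]]]]]]]].
have [/= fz0 _] := nbhs_singleton lF; have [_ lFz0] := nbhs_singleton lg.
rewrite /pts /= -pE fz0 -memvE -kerl memv_ker lFz0 expr0 mul1r.
by rewrite (negbTE gz0).
Qed.

Lemma sum2_two_points (T : eqType) (s : seq T) (mu : T -> nat) p q : uniq s ->
  p \in s -> q \in s -> p != q -> (forall x, x \in s -> 0 < mu x)%N ->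
  (\sum_(x <- s) mu x)%N = 2 ->
  [/\ mu p = 1%N, mu q = 1%N & forall x, x \in s -> x = p \/ x = q].
Proof.
move=> us ps qs pq mu0 sum2.
have up := rem_uniq p us.
have qs' : q \in rem p s by rewrite mem_rem_uniq // inE eq_sym pq.
have := sum2; rewrite (big_rem p ps) /= (big_rem q qs') /=.
have mp := mu0 p ps; have mq := mu0 q qs => sumE.
split; [lia | lia | move=> x xs].
have [->|xp] := eqVneq x p; [by left | have [->|xq] := eqVneq x q; first by right].
have xs' : x \in rem q (rem p s) by rewrite mem_rem_uniq // inE xq mem_rem_uniq // inE xp.
by move: mp mq sumE (mu0 x xs); rewrite (big_rem x xs') /=; clear; lia.
Qed.

(** The degree forces x0 and xoo to be the only points of the curve in H, each hit once
    with multiplicity 1.  Let a and b represent their parameters; mobius a b moves these to 0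
    and infinity, where conic_of_lifts applies.  Rescaling the two homogeneous coordinates by
    square roots of c0 and c1 then replaces the vectors v0 and v1 by the given generators
    X0 = c0 v0 and Xoo = c1 v1. *)
Lemma conic_normal_form n (H : {vspace 'rV[C]_n.+1}) (x0 xoo : CP n)
    (X0 Xoo : 'rV[C]_n.+1) (f : CP 1 -> CP n) :
  hyperplane H -> pts H x0 -> pts H xoo -> x0 <> xoo ->
  X0 != 0 -> val x0 = <[X0]>%VS -> Xoo != 0 -> val xoo = <[Xoo]>%VS ->
  rational_curve 2 f -> ~ (range f `<=` pts H) -> range f x0 -> range f xoo ->
  exists (a b : 'rV[C]_2) (e : 'rV[C]_n.+1), [/\ bracket a b != 0, e \notin H &
    forall p u, u != 0 -> val p = <[u]>%VS ->
      val (f (mobius a b p)) = <[conic X0 e Xoo u]>%VS].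
Proof.
move=> dH Hx0 Hxoo x0oo X00 x0E Xoo0 xooE [hf degf] notH [p0 _ fp0] [p1 _ fp1].
have [s [mu [us [zeros [mult sum2]]]]] := degf H dH notH.
have p0s : p0 \in s by apply/zeros; rewrite fp0.
have p1s : p1 \in s by apply/zeros; rewrite fp1.
have p01 : p0 != p1 by apply/eqP => p01; apply: x0oo; rewrite -fp0 -fp1 p01.
have mu_gt0 p : p \in s -> (0 < mu p)%N.
  by move=> ps; apply: inter_mult_gt0 (mult p ps) _; apply/zeros.
have [mu0 mu1 s01] := sum2_two_points us p0s p1s p01 mu_gt0 sum2.
have [l kerl] := hyperplane_form dH.
have [e eH] := hyperplane_proper dH; rewrite -kerl in eH.
have [a a0 p0E] := point_line p0; have [b b0 p1E] := point_line p1.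
have ab : bracket a b != 0.
  apply: contraNneq p01 => /(bracket_eq0 a0 b0) E.
  by apply/eqP/val_inj; rewrite p0E p1E.
have M0 : mobius a b (chart 0 0) = p0.
  apply: val_inj; rewrite (mobiusE ab (chart_vec_neq0 0 0)) // p0E.
  by rewrite /lin2 !mxE /= scale1r scale0r addr0.
have M1 : mobius a b (chart 1 0) = p1.
  apply: val_inj; rewrite (mobiusE ab (chart_vec_neq0 1 0)) // p1E.
  by rewrite /lin2 !mxE /= scale1r scale0r add0r.
have fH z : z != 0 -> ~ pts (lker l) ((f \o mobius a b) (chart 0 z)).
  move=> z0; rewrite kerl => /zeros /s01.
  have neq i : bracket (chart_vec 0 z) (chart_vec i 0) != 0 ->
      mobius a b (chart 0 z) <> mobius a b (chart i 0).
    move=> + /(can_inj (mobiusK ab)) /(congr1 val).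
    by move=> /[swap] /(bracket_eq0 (chart_vec_neq0 _ _) (chart_vec_neq0 _ _)) ->; rewrite eqxx.
  rewrite -M0 -M1; case; apply: neq.
    by rewrite bracket_chart_sign sub0r mulf_neq0 ?oppr_eq0 // chart_sign_neq0.
  by rewrite /bracket !mxE /= mulr0 subr0 mulr1 oner_neq0.
have [F0 [g0 [lF0 g00 lg0]]] : exists (F : C -> 'rV[C]_n.+1) (g : C -> C),
    [/\ lift_near (f \o mobius a b \o chart 0) 0 F, g 0 != 0
      & \forall z \near (0 : C^o), holomorphic_at g z /\ l (F z) = (z - 0) ^+ 1 * g z].
  by apply: (inter_mult_mobius ab eH); rewrite M0 kerl -mu0; exact: mult.
have [F1 [g1 [lF1 g10 lg1]]] : exists (F : C -> 'rV[C]_n.+1) (g : C -> C),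
    [/\ lift_near (f \o mobius a b \o chart 1) 0 F, g 0 != 0
      & \forall z \near (0 : C^o), holomorphic_at g z /\ l (F z) = (z - 0) ^+ 1 * g z].
  by apply: (inter_mult_mobius ab eH); rewrite M1 kerl -mu1; exact: mult.
have hfM := holomorphic_comp_mobius ab hf.
have [v0 [v [v1 [/= fv0 fv1 lv fE]]]] := conic_of_lifts hfM fH lF0 g00 lg0 lF1 g10 lg1.
rewrite M0 fp0 x0E in fv0; rewrite M1 fp1 xooE in fv1.
have [c0 c00 X0E] := vline_eq X00 fv0; have [c1 c10 XooE] := vline_eq Xoo0 fv1.
pose s0 := sqrtC c0; pose s1 := sqrtC c1.
have s00 : s0 != 0 by rewrite sqrtC_eq0.
have s10 : s1 != 0 by rewrite sqrtC_eq0.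
pose c := s0 *: chart_vec 0 0; pose d := s1 *: chart_vec 1 0.
have cd : bracket c d != 0.
  by rewrite bracketZl bracketZr /bracket !mxE /= mulr0 subr0 !mulr1 mulf_neq0.
exists (lin2 a b c), (lin2 a b d), ((s0 * s1) *: v); split.
- by rewrite bracket_lin2 mulf_neq0.
- rewrite -kerl memv_ker linearZ /= lv.
  by rewrite [_ *: _]mulr1 mulf_neq0.
move=> p u u0 pu; rewrite -mobius_comp //.
rewrite (fE _ _ ((homogeneous_lin2 cd).2 u u0) (mobiusE cd u0 pu)).
by rewrite -conic_rescale X0E XooE !sqrtCK.
Qed.

(** The map x |-> x + (l x / l e) (e' - e), where l is a form with kernel H; it is
    injective because l (L x) = (l x / l e) (l e'). *)
Lemma exists_shear n (H : {vspace 'rV[C]_n.+1}) (e e' : 'rV[C]_n.+1) :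
  hyperplane H -> e \notin H -> e' \notin H ->
  exists L : 'End('rV[C]_n.+1),
    [/\ lker L = 0%VS, forall x, x \in H -> L x = x & L e = e'].
Proof.
move=> dH eH e'H; have [l kerl] := hyperplane_form dH.
have le : l e != 0 by rewrite -memv_ker kerl.
have le' : l e' != 0 by rewrite -memv_ker kerl.
pose t (x : 'rV[C]_n.+1) := (l x / l e : C) *: (e' - e).
have t_lin : linear t.
  move=> k x y; rewrite /t; have -> : l (k *: x + y) = k * l x + l y by rewrite linearP.
  by rewrite mulrDl scalerDl -mulrA scalerA.
pose tL : {linear 'rV[C]_n.+1 -> 'rV[C]_n.+1} :=
  HB.pack t (GRing.isLinear.Build _ _ _ _ _ t_lin).
pose L : 'End('rV[C]_n.+1) := (\1 + linfun tL)%VF.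
have LE x : L x = x + t x by rewrite add_lfunE id_lfunE lfunE.
exists L; split.
- apply/eqP; rewrite -subv0; apply/subvP => x; rewrite memv_ker memv0 LE => /eqP Lx.
  have lx : l x = 0.
    have E : l x + l x / l e * (l e' - l e) = 0.
      by have := congr1 l Lx; rewrite linearD linearZ linearB linear0.
    apply: (mulIf le'); rewrite mul0r -[RHS](mulr0 (l e)) -[in RHS]E.
    by field.
  by move: Lx; rewrite /t lx mul0r scale0r addr0 => ->.
- move=> x; rewrite -kerl memv_ker => /eqP lx.
  by rewrite LE /t lx mul0r scale0r addr0.
- by rewrite LE /t divff // scale1r addrC subrK.
Qed.

Definition linear_action n (L : 'End('rV[C]_n.+1)) (p : CP n) : CP n :=
  insubd p (L @: val p)%VS.

Lemma linear_actionE n (L : 'End('rV[C]_n.+1)) p :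
  lker L = 0%VS -> val (linear_action L p) = (L @: val p)%VS.
Proof.
move=> kerL; rewrite val_insubd limg_dim_eq ?kerL ?capv0 //.
by rewrite (valP p).
Qed.

Theorem proposition1p2 (n : nat) (H : {vspace 'rV[C]_n.+1}) (x0 xoo : CP n) :
  hyperplane H -> pts H x0 -> pts H xoo -> x0 <> xoo ->
  let admissible (f : CP 1 -> CP n) :=
    rational_curve 2 f /\ ~ (range f `<=` pts H) /\
    range f x0 /\ range f xoo in
  (exists f, admissible f) /\
  (forall f1 f2, admissible f1 -> admissible f2 ->
     exists g, Aut H g /\ same_curve (g \o f1) f2).
Proof.
move=> dH Hx0 Hxoo x0oo admissible.
have [X0 X00 x0E] := point_line x0; have [Xoo Xoo0 xooE] := point_line xoo.
have X0H : X0 \in H by move: Hx0; rewrite /pts /= x0E -memvE.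
have XooH : Xoo \in H by move: Hxoo; rewrite /pts /= xooE -memvE.
split.
  have [e eH] := hyperplane_proper dH.
  have hom := homogeneous_conic X0H XooH eH X00 Xoo0.
  have fE i z := descendE x0 hom (chart_vec_neq0 i z) (erefl (val (chart i z))).
  exists (descend (conic X0 e Xoo) x0); split; [split|split; [|split]].
  - apply: (holomorphic_descend _ hom) => i j z.
    exact: holomorphic_conic.
  - exact: has_degree_conic.
  - move=> /(_ (descend (conic X0 e Xoo) x0 (chart 0 1))) in_H.
    have : conic X0 e Xoo (chart_vec 0 1) \in H.
      by rewrite memvE -fE; apply: in_H; exists (chart 0 1).
    rewrite /conic !mxE /= mulr1 !expr1n !scale1r rpredDr // rpredDl //.
    exact/negP.
  - exists (chart 0 0) => //; apply: val_inj; rewrite fE x0E.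
    by rewrite /conic !mxE /= mulr0 expr1n expr0n /= !scale0r !addr0 scale1r.
  - exists (chart 1 0) => //; apply: val_inj; rewrite fE xooE.
    by rewrite /conic !mxE /= mul0r expr1n expr0n /= !scale0r !add0r scale1r.
move=> f1 f2 [rf1 [nH1 [f1x0 f1xoo]]] [rf2 [nH2 [f2x0 f2xoo]]].
have [a1 [b1 [e1 [ab1 e1H f1E]]]] := conic_normal_form dH Hx0 Hxoo x0oo X00 x0E Xoo0 xooE
  rf1 nH1 f1x0 f1xoo.
have [a2 [b2 [e2 [ab2 e2H f2E]]]] := conic_normal_form dH Hx0 Hxoo x0oo X00 x0E Xoo0 xooE
  rf2 nH2 f2x0 f2xoo.
have [L [kerL LH Le]] := exists_shear dH e1H e2H.
exists (linear_action L); split.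
  split; first by exists L; split=> // p; exact: linear_actionE.
  move=> p pH; apply: val_inj; rewrite linear_actionE //.
  have [u u0 pu] := point_line p; rewrite pu limg_line LH //.
  by move: pH; rewrite /pts /= pu -memvE.
have ab2' : bracket (adjl a2 b2) (adjr a2 b2) != 0 by rewrite bracket_adj.
(* This is mobius a1 b1 composed with the inverse of mobius a2 b2: in the parameters
   given by the normal form, both curves are conics that differ by the linear map L. *)
exists (mobius (lin2 a1 b1 (adjl a2 b2)) (lin2 a1 b1 (adjr a2 b2))); split.
  by apply: reparametrization_mobius; rewrite bracket_lin2 mulf_neq0.
apply/funext => p /=; rewrite -mobius_comp // -{1}(mobius_adjK ab2 p).
set q := mobius (adjl _ _) _ p; have [u u0 qu] := point_line q.
apply: val_inj; rewrite (f2E q u u0 qu) linear_actionE // (f1E q u u0 qu) limg_line.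
by rewrite /conic !linearD !linearZ /= Le !LH.
Qed.
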